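(* Let $(Q,L,C_K,C_V)$ be a second order constrained Lagrangian system (SOCS) with flow $F_L:TQ\times\mathbb{R}\to TQ$, let $t$ be any fixed time, and write $F_L^s:=F_L(\cdot,s):TQ\to TQ$. Then $$(F_L^t)^*(\Omega_L)=\Omega_L+d\nu,$$ where $\Omega_L$ is the Lagrangian $2$-form of $L$ and $\nu\in\Omega^1(TQ)$ is the $1$-form defined by $$\nu(q,\dot q)(\delta q,\delta\dot q):=\int_0^t D_{EL}L(\gamma^{(2)}(s))(\delta q(s))\,ds,\qquad \forall (\delta q,\delta\dot q)\in T_{(q,\dot q)}(TQ).$$ Here $\gamma$ is the trajectory of the system with initial conditions $(q,\dot q)$ and, for $s\in[0,t]$, $$\delta q(s):=D(\tau_Q\circ F_L^s)(q,\dot q)(\delta q,\delta\dot q)\in T_{\gamma(s)}Q .$$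
   Context: Notation: $\tau_X:TX\to X$ is the tangent bundle projection. $T^{(2)}Q$ is the second order tangent bundle of $Q$ ($2$-jets at $0$ of curves in $Q$), with fiber $T^{(2)}_qQ$ over $q$. For a smooth curve $\gamma$ in $Q$, $\gamma'(t)\in TQ$ is its velocity and $\gamma^{(2)}(t)\in T^{(2)}Q$ its $2$-lift. A second order constrained Lagrangian system (SOCS) is a quadruple $(Q,L,C_K,C_V)$ where: $Q$ is a finite dimensional differentiable manifold; $L:TQ\to\mathbb{R}$ is smooth; $C_K\subset T^{(2)}Q$ is a submanifold; and $C_V\subset T^{(2)}Q\times_Q TQ$ is such that for every $q\in Q$ and $\eta\in T_q^{(2)}Q$ the set $C_V|_\eta:=C_V\cap(\{\eta\}\times T_qQ)$, identified with a subset of $T_qQ$, is either empty or a vector subspace. The action of a smooth curve $\gamma:[t_0,t_1]\to Q$ is $S(\gamma):=\int_{t_0}^{t_1}L(\gamma'(t))\,dt$. An infinitesimal variation of $\gamma$ is a smooth curve $\delta\gamma:[t_0,t_1]\to TQ$ with $\tau_Q(\delta\gamma(t))=\gamma(t)$ for all $t$; it has vanishing end points if $\delta\gamma(t_0)=0$ and $\delta\gamma(t_1)=0$. $dS(\gamma)(\delta\gamma)$ is the derivative at $\epsilon=0$ of $S(\gamma_\epsilon)$ for any smooth deformation $\gamma_\epsilon$ of $\gamma$ with $\frac{d}{d\epsilon}|_{\epsilon=0}\gamma_\epsilon=\delta\gamma$. The curve $\gamma$ is a trajectory of the SOCS if (1) $\gamma^{(2)}(t)\in C_K$ for all $t\in[t_0,t_1]$,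 and (2) $dS(\gamma)(\delta\gamma)=0$ for all infinitesimal variations $\delta\gamma$ with vanishing end points such that $\delta\gamma(t)\in C_V|_{\gamma^{(2)}(t)}$ for all $t\in[t_0,t_1]$. Flow: issues of global versus local flows are ignored, so the SOCS is assumed to have a (globally defined) flow, i.e. a smooth map $F_L:TQ\times\mathbb{R}\to TQ$ such that, for every $(q,\dot q)\in TQ$, the curve $\gamma(s)=\tau_Q(F_L((q,\dot q),s))$ satisfies $\gamma'(s)=F_L((q,\dot q),s)$ for all $s$, $\gamma'(0)=(q,\dot q)$, and its restriction to each compact interval containing $0$ is the unique trajectory of the SOCS on that interval with initial velocity $(q,\dot q)$ at time $0$. This $\gamma$ is ''the trajectory with initial conditions $(q,\dot q)$''. The Euler–Lagrange map $D_{EL}L:T^{(2)}Q\to T^*Q$ covers the identity of $Q$ and is given in local coordinates by $D_{EL}L(\gamma^{(2)}(t))=\left(\frac{\partial L}{\partial q^i}(\gamma'(t))-\frac{d}{dt}\frac{\partial L}{\partial\dot q^i}(\gamma'(t))\right)dq^i$. The Legendre transform $\mathcal{F}L:TQ\to T^*Q$ is $\mathcal{F}L(v_q)(w_q):=\frac{d}{dz}\big|_{z=0}L(v_q+z\,w_q)$ for $v_q,w_q\in T_qQ$. The Lagrangian $1$-form $\theta_L\in\Omega^1(TQ)$ is $\theta_L(v_q)(V_{v_q}):=\mathcal{F}L(v_q)(D\tau_Q(v_q)(V_{v_q}))$ for $V_{v_q}\in T_{v_q}(TQ)$, and the Lagrangian $2$-form is $\Omega_L:=-d\theta_L$. No regularity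 of $L$ is assumed. *)

(* Defs.v *)
(* Smooth manifolds over MathComp-Analysis, presented by atlases, together with
   the part of Lagrangian mechanics needed for second order constrained
   systems.

   Manifolds are sets with an atlas; their topology is the one induced by the
   atlas.  The structure [charts E] only contains the charts; the compatibility,
   Hausdorff and countability axioms are in [manifold].  In this way the
   tangent bundle, the second order tangent bundle and products are given by
   their usual charts, and smoothness, differentials and forms are defined on
   all of them at once. *)
From HB Require Import structures.
From mathcomp Require Import all_boot all_order all_algebra.
From mathcomp Require Import all_classical all_reals all_analysis.

Set Implicit Arguments.
Unset Strict Implicit.
Unset Printing Implicit Defensive.

Import Order.TTheory GRing.Theory Num.Theory.
Import numFieldNormedType.Exports.

Local Open Scope classical_set_scope.
Local Open Scope ring_scope.

Section calculus.
Context {R : realType}.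

(* Only used between finite dimensional spaces, where this is the usual notion
   (existence and continuity of the iterated directional derivatives). *)
Fixpoint Ck_on (V W : normedModType R) (k : nat) (U : set V) (f : V -> W) : Prop :=
  if k is k'.+1 then
    (forall x, U x -> differentiable f x) /\
    (forall v, Ck_on k' U (fun x => 'd f x v))
  else forall x, U x -> {for x, continuous f}.

Definition smooth_on (V W : normedModType R) (U : set V) (f : V -> W) : Prop :=
  forall k, Ck_on k U f.

Definition smooth_near (V W : normedModType R) (f : V -> W) (x : V) : Prop :=
  exists U : set V, [/\ open U, U x & smooth_on U f].

Definition linear_subspace (V : lmodType R) (W : set V) : Prop :=
  W 0 /\ forall (a : R) (x y : V), W x -> W y -> W (a *: x + y).

(* \int_a^b f, also for b < a *)
Definition oriented_integral (a b : R) (f : R -> R) : R :=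
  if a <= b then \int[lebesgue_measure]_(x in `[a, b]) f x
  else - \int[lebesgue_measure]_(x in `[b, a]) f x.

End calculus.

(* [phi i] is a bijection from [dom i] onto a subset of the model space E, with
   inverse [psi i]; values outside of these sets are irrelevant. *)
Record charts (R : realType) (E : normedModType R) := Charts {
  pt :> Type ;
  idx : Type ;
  dom : idx -> set pt ;
  phi : idx -> pt -> E ;
  psi : idx -> E -> pt ;
  chart_at : pt -> idx }.

Arguments dom {R E} M i _ : rename.
Arguments phi {R E} M i _ : rename.
Arguments psi {R E} M i _ : rename.
Arguments chart_at {R E} M _ : rename.

Definition chart_image {R : realType} {E : normedModType R} (M : charts E)
  (i : idx M) : set E := phi M i @` dom M i.

Definition chart_open {R : realType} {E : normedModType R} (M : charts E)
  (A : set M) : Prop := forall i : idx M, open (phi M i @` (dom M i `&` A)).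

Record manifold (R : realType) (n : nat) := Manifold {
  atlas :> charts 'rV[R]_n ;
  chart_atP : forall q : atlas, dom atlas (chart_at atlas q) q ;
  phiK : forall i (q : atlas), dom atlas i q -> psi atlas i (phi atlas i q) = q ;
  open_overlap : forall i j : idx atlas,
    open (phi atlas i @` (dom atlas i `&` dom atlas j)) ;
  smooth_overlap : forall i j : idx atlas,
    smooth_on (phi atlas i @` (dom atlas i `&` dom atlas j))
      (phi atlas j \o psi atlas i) ;
  hausdorff : forall p q : atlas, p <> q ->
    exists A B : set atlas,
      [/\ chart_open A, chart_open B, A p, B q & A `&` B = set0] ;
  second_countable : exists B : nat -> set atlas,
    (forall k, chart_open (B k)) /\
    (forall (A : set atlas) q, chart_open A -> A q ->
       exists2 k, B k q & B k `<=` A) }.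

Section maps.
Context {R : realType}.

Definition vector_charts (E : normedModType R) : charts E :=
  @Charts R E E unit (fun=> setT) (fun=> id) (fun=> id) (fun=> tt).

Definition prod_charts (E F : normedModType R) (M : charts E) (N : charts F) :
    charts (E * F)%type :=
  @Charts R (E * F)%type (M * N)%type (idx M * idx N)%type
    (fun i => [set p | dom M i.1 p.1 /\ dom N i.2 p.2])
    (fun i p => (phi M i.1 p.1, phi N i.2 p.2))
    (fun i x => (psi M i.1 x.1, psi N i.2 x.2))
    (fun p => (chart_at M p.1, chart_at N p.2)).

Definition smooth_at (E F : normedModType R) (M : charts E) (N : charts F)
    (f : M -> N) (p : M) : Prop :=
  forall (i : idx M) (j : idx N), dom M i p -> dom N j (f p) ->
    (\forall x \near phi M i p, dom N j (f (psi M i x))) /\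
    smooth_near (phi N j \o f \o psi M i) (phi M i p).

Definition smooth_map (E F : normedModType R) (M : charts E) (N : charts F)
  (f : M -> N) : Prop := forall p, smooth_at f p.

(* Smooth curves on a compact interval [a, b] are those that are smooth on a
   neighbourhood of [a, b]. *)
Definition smooth_curve_on (E : normedModType R) (M : charts E) (a b : R)
    (c : R -> M) : Prop :=
  forall t, a <= t <= b -> smooth_at (c : vector_charts R -> M) t.

(* Embedded submanifolds: C is locally the slice { h \in W } for a local
   diffeomorphism h of the model space and a fixed linear subspace W. *)
Definition submanifold (E : normedModType R) (M : charts E) (C : set M) : Prop :=
  exists2 W : set E, linear_subspace W &
  forall p, C p ->
  exists i : idx M, dom M i p /\
  exists (U : set E) (h h' : E -> E),
    [/\ [/\ open U, U (phi M i p) & U `<=` chart_image i],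
        [/\ smooth_on U h, open (h @` U), smooth_on (h @` U) h' &
            forall x, U x -> h' (h x) = x] &
        forall q, dom M i q -> U (phi M i q) -> (C q <-> W (h (phi M i q)))].

End maps.

(* A tangent vector at p is the family of its components in the charts around
   p (with value 0 at the other charts). *)
Section tangent_space.
Context {R : realType} {E : normedModType R} (M : charts E) (p : M).

Definition tangent_pred : {pred idx M -> E} := fun u =>
  `[< (forall i, ~ dom M i p -> u i = 0) /\
      (forall i j, dom M i p -> dom M j p ->
         u j = 'd (phi M j \o psi M i) (phi M i p) (u i)) >].

Lemma tangent_submod_closed : GRing.submod_closed tangent_pred.
Proof.
split.
  by apply/asboolP; split => [//|i j _ _]; rewrite linear0.
move=> a u v /asboolP[u0 uE] /asboolP[v0 vE]; apply/asboolP; split=> [i pi|i j pi pj].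
  by rewrite !fctE u0// v0// scaler0 addr0.
by rewrite !fctE (uE i j)// (vE i j)// linearP.
Qed.

HB.instance Definition _ :=
  GRing.isSubmodClosed.Build R (idx M -> E) tangent_pred tangent_submod_closed.

Record tangent_space := TangentVector {
  comp :> idx M -> E ;
  compP : comp \in tangent_pred }.

HB.instance Definition _ := [isSub for comp].
HB.instance Definition _ := [Choice of tangent_space by <:].
HB.instance Definition _ := [SubChoice_isSubLmodule of tangent_space by <:].

End tangent_space.


Arguments tangent_pred {R E M} p.

Section tangent_bundle.
Context {R : realType} {E : normedModType R} (M : charts E).

Definition mk_tangent (p : M) (u : idx M -> E) : tangent_space p := insubd 0 u.

(* the vector with components [w] in the chart [i] *)
Definition tangent_vector (i : idx M) (p : M) (w : E) : tangent_space p :=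
  mk_tangent p (fun j =>
    if `[< dom M j p >] then 'd (phi M j \o psi M i) (phi M i p) w else 0).

Definition tangent_bundle : charts (E * E)%type :=
  @Charts R (E * E)%type {p : M & tangent_space p} (idx M)
    (fun i v => dom M i (projT1 v))
    (fun i v => (phi M i (projT1 v), comp (projT2 v) i))
    (fun i z => existT _ (psi M i z.1) (tangent_vector i (psi M i z.1) z.2))
    (fun v => chart_at M (projT1 v)).

Definition tau (v : tangent_bundle) : M := projT1 v.

Definition velocity (c : R -> M) (t : R) : tangent_space (c t) :=
  mk_tangent (c t) (fun i =>
    if `[< dom M i (c t) >] then derive1 (phi M i \o c) t else 0).

(* c'(t) *)
Definition lift (c : R -> M) (t : R) : tangent_bundle :=
  existT _ (c t) (velocity c t).

End tangent_bundle.

Arguments tau {R E M} v.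

Definition differential {R : realType} {E F : normedModType R} {M : charts E}
    {N : charts F} (f : M -> N) (p : M) (u : tangent_space p) :
    tangent_space (f p) :=
  mk_tangent (f p) (fun j =>
    let i := chart_at M p in
    if `[< dom N j (f p) >] then 'd (phi N j \o f \o psi M i) (phi M i p) (u i)
    else 0).

(* A 2-jet at q is recorded by the first and second derivatives, in the charts
   around q (and 0 at the other charts), of a curve c with c 0 = q. *)
Section jets.
Context {R : realType} {E : normedModType R} (M : charts E).

Definition jet2_comp (c : R -> M) (t : R) (i : idx M) : E * E :=
  if `[< dom M i (c t) >] then (derive1 (phi M i \o c) t, derive1n 2 (phi M i \o c) t)
  else 0.

Definition is_jet2 (q : M) (u : idx M -> E * E) : Prop :=
  exists c : R -> M,
    [/\ smooth_at (c : vector_charts R -> M) 0, c 0 = q & u = jet2_comp c 0].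

Definition jet2_space (q : M) := {u : idx M -> E * E | is_jet2 q u}.

Lemma Ck_cst (V W : normedModType R) k (U : set V) (w : W) :
  Ck_on k U (fun=> w).
Proof.
elim: k w => [|k IH] w /=; first by move=> x _; exact: cst_continuous.
split=> [x _|v]; first exact: differentiable_cst.
rewrite (_ : (fun _ => _) = fun=> 0); first exact: IH.
by apply/funext => x; rewrite diff_cst.
Qed.

Lemma cst_is_jet2 (q : M) : is_jet2 q (fun=> 0).
Proof.
exists (fun=> q); split=> //.
  move=> i j _ qj; split; first by near=> x.
  by exists setT; split=> //; [exact: openT | move=> k; exact: Ck_cst].
apply/funext => i; rewrite /jet2_comp; case: ifP => // _.
rewrite (_ : phi M i \o _ = fun=> phi M i q)//.
have dcst (w : E) : derive1 (fun=> w) = (fun=> 0) :> (R -> E).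
  by apply/funext => t; rewrite derive1E derive_cst.
by rewrite /derive1n /= !dcst.
Unshelve. all: by end_near.
Qed.

(* c^(2)(t), the 2-jet at 0 of the curve s |-> c (t + s); the default value (the
   jet of a constant curve) is used only if c is not smooth at t *)
Definition jet2 (c : R -> M) (t : R) : jet2_space (c t) :=
  if pselect (is_jet2 (c t) (jet2_comp c t)) is left h then exist _ _ h
  else exist _ _ (cst_is_jet2 (c t)).

Definition jet2_bundle : charts (E * (E * E))%type :=
  @Charts R (E * (E * E))%type {q : M & jet2_space q} (idx M)
    (fun i eta => dom M i (projT1 eta))
    (fun i eta => (phi M i (projT1 eta), sval (projT2 eta) i))
    (fun i z =>
       let c s := psi M i (z.1 + s *: z.2.1 + (s ^+ 2 / 2) *: z.2.2) in
       existT _ (c 0) (jet2 c 0))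
    (fun eta => chart_at M (projT1 eta)).

Definition lift2 (c : R -> M) (t : R) : jet2_bundle := existT _ (c t) (jet2 c t).

End jets.

Section forms.
Context {R : realType} {E : normedModType R} (M : charts E).

Definition form1 := forall p : M, tangent_space p -> R.
Definition form2 := forall p : M, tangent_space p -> tangent_space p -> R.

(* membership in Omega^1(M) *)
Definition smooth_form1 (omega : form1) : Prop :=
  (forall (p : M) (a : R) (u v : tangent_space p),
     omega p (a *: u + v) = a * omega p u + omega p v) /\
  (forall (i : idx M) (w : E),
     smooth_on (chart_image i)
       (fun x => omega (psi M i x) (tangent_vector i (psi M i x) w))).

(* d omega (u, v) = (d_k omega_l - d_l omega_k) u^k v^l *)
Definition exterior_derivative (omega : form1) : form2 := fun p u v =>
  let i := chart_at M p in
  let omega_loc w x := omega (psi M i x) (tangent_vector i (psi M i x) w) in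
  'd (omega_loc (v i)) (phi M i p) (u i) - 'd (omega_loc (u i)) (phi M i p) (v i).

End forms.

Definition pullback2 {R : realType} {E F : normedModType R} {M : charts E}
    {N : charts F} (f : M -> N) (omega : form2 N) : form2 M :=
  fun p u v => omega (f p) (differential f u) (differential f v).

Section lagrangian.
Context {R : realType} {E : normedModType R} (Q : charts E).
Local Notation TQ := (tangent_bundle Q).
Variable L : TQ -> R.

(* (q, v, a) : T^(2)Q is sent to dL/dq - d/dt (dL/dq'), where d/dt is the
   derivative of a function of (q, q') in the direction (v, a). *)
Definition euler_lagrange (q : Q) (eta : jet2_space q) (w : tangent_space q) : R :=
  let i := chart_at Q q in
  let va := sval eta i in
  let Lloc z := L (psi TQ i z) in
  'd Lloc (phi Q i q, va.1) (w i, 0)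
  - 'd (fun z => 'd Lloc z (0, w i)) (phi Q i q, va.1) va.

Definition legendre (q : Q) (v w : tangent_space q) : R :=
  derive1 (fun z : R => L (existT _ q (v + z *: w))) 0.

Definition lagrangian_form1 : form1 TQ :=
  fun v V => legendre (projT2 v) (differential (tau : TQ -> Q) V).

Definition lagrangian_form2 : form2 TQ :=
  fun v V W => - exterior_derivative lagrangian_form1 V W.

Definition action (t0 t1 : R) (c : R -> Q) : R :=
  \int[lebesgue_measure]_(t in `[t0, t1]) L (lift c t).

(* dS(c)(delta) = l: a relation, since the derivative is computed along an
   arbitrary smooth deformation G of c with d/de G(e, .) = delta at e = 0. *)
Definition action_differential (t0 t1 : R) (c : R -> Q)
    (delta : forall t, tangent_space (c t)) (l : R) : Prop :=
  forall G : R -> R -> Q,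
    (forall t, t0 <= t <= t1 ->
       smooth_at
         ((fun z => G z.1 z.2) : prod_charts (vector_charts R) (vector_charts R) -> Q)
         (0, t)) ->
    (forall t, t0 <= t <= t1 -> G 0 t = c t) ->
    (forall t, t0 <= t <= t1 ->
       lift (G ^~ t) 0 = existT _ (c t) (delta t) :> TQ) ->
    is_derive (0 : R) (1 : R) (fun e => action t0 t1 (G e)) l.

End lagrangian.

Record socs (R : realType) (n : nat) (Q : manifold R n) := Socs {
  lagrangian : tangent_bundle Q -> R ;
  CK : set (jet2_bundle Q) ;
  CV : forall q : Q, jet2_space q -> set (tangent_space q) ;
  lagrangian_smooth :
    smooth_map (lagrangian : tangent_bundle Q -> vector_charts R) ;
  CK_submanifold : submanifold CK ;
  CV_subspace : forall (q : Q) (eta : jet2_space q),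
    CV eta = set0 \/ linear_subspace (CV eta) }.

Section dynamics.
Context {R : realType} {n : nat} {Q : manifold R n} (S : socs Q).
Local Notation TQ := (tangent_bundle Q).

Definition trajectory (t0 t1 : R) (c : R -> Q) : Prop :=
  [/\ smooth_curve_on t0 t1 c,
      forall t, t0 <= t <= t1 -> CK S (lift2 c t) &
      forall delta : (forall t, tangent_space (c t)),
        smooth_curve_on t0 t1 (fun t => existT _ (c t) (delta t) : TQ) ->
        delta t0 = 0 -> delta t1 = 0 ->
        (forall t, t0 <= t <= t1 -> CV S (jet2 c t) (delta t)) ->
        action_differential (lagrangian S) t0 t1 delta 0].

Definition is_flow (F : TQ -> R -> TQ) : Prop :=
  smooth_map ((fun z => F z.1 z.2) : prod_charts TQ (vector_charts R) -> TQ) /\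
  forall v : TQ,
    let c s := tau (F v s) in
    [/\ forall s, lift c s = F v s,
        lift c 0 = v &
        forall a b, a < b -> a <= 0 <= b ->
          trajectory a b c /\
          forall c', trajectory a b c' -> lift c' 0 = v ->
            forall s, a <= s <= b -> c' s = c s].

End dynamics.

(* Main.v *)
(* With theta the Lagrangian 1-form and F^s the flow, differentiating
   (F^s)^* theta (V) = D_2 L (delta q) in s gives
     d/ds (F^s)^* theta = d (L o F^s) - D_EL L (gamma^(2)(s)) (delta q (s)),
   because delta(q') = (delta q)'.  Integrating over [0, t],
     nu = d (int_0^t L o F^s ds) - (F^t)^* theta + theta,
   which shows that nu is smooth, and applying -d yields the claim.  The
   identity in s is pointwise, so each s may use its own chart around gamma(s)
   and no invariance of D_EL L under changes of charts is needed. *)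
From HB Require Import structures.
Require Import Defs.
From mathcomp Require Import all_boot all_order all_algebra.
From mathcomp Require Import all_classical all_reals all_analysis.
From mathcomp Require Import ring lra.

Set Implicit Arguments.
Unset Strict Implicit.
Unset Printing Implicit Defensive.

Import Order.TTheory GRing.Theory Num.Theory.
Import numFieldNormedType.Exports.

Local Open Scope classical_set_scope.
Local Open Scope ring_scope.

(** * Differentials and iterated differentiability *)

(** A trajectory may cross many charts during [0, t], so the integrand of nu has no single
    coordinate expression in which to differentiate under the integral sign. The formula for nu
    avoids this: the only integral to be differentiated in the initial condition is that of the
    scalar [L] along the flow, which needs a chart at the initial point alone, while the boundary
    terms need one chart at time 0 and one at time t. Likewise, d d = 0 and the commutation of d
    with pullback are used in coordinates only, where they become the symmetry of a second
    differential: that of the action integral for the former, that of the flow map for the latter.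
    The same symmetry, between time and the initial condition, is the rule delta(q') = (delta q)'.
    Since [smooth_on] speaks of differentials in fixed directions, chain rules with a varying
    direction come from expanding that direction in finitely many coordinates. *)

Section differentials.
Context {R : realType}.
Implicit Types U V W : normedModType R.

(** Replaces the shifted little-o by an inequality at [x] itself, the form suited to near equalities
    and to explicit estimates. *)
Lemma is_diffP V W (f df : V -> W) (x : V) : linear df -> continuous df ->
  is_diff x f df <->
  (forall e : R, 0 < e ->
     \forall y \near x, `|f y - f x - df (y - x)| <= e * `|y - x|).
Proof.
move=> dfl dfc.
have lim_x : lim (nbhs x) = x by exact: lim_id.
pose dL : {linear V -> W} := HB.pack df (GRing.isLinear.Build _ _ _ _ _ dfl).
split.
  move=> [] /diffP [_ fE] dE e e0.
  have /eqaddoP/(_ e e0) := funext fE.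
  rewrite lim_x; apply: filterS => y; rewrite !fctE.
  by rewrite dE opprD addrA.
move=> h.
have hf : f \o shift x = cst (f x) + dL +o_ 0 id.
  apply/eqaddoP => e e0; have := h e e0; rewrite (near_shift 0 x) /=.
  by apply: filterS => y /=; rewrite !fctE /= subr0 addrK opprD addrA.
have dE : 'd f x = df :> (V -> W).
  by have -> : df = dL by []; apply: diff_unique.
apply: DiffDef => //; apply/diff_locallyP; rewrite dE.
by split=> //.
Qed.

(** Two chart expressions of one map agree only near a point; this is the rule that carries
    differentials from one to the other. *)
Lemma is_diff_near V W (f g df : V -> W) (x : V) :
  (\forall y \near x, f y = g y) -> is_diff x f df -> is_diff x g df.
Proof.
move=> fg fdf.
have [dl dc] : linear df /\ continuous df.
  rewrite -(@diff_val _ _ _ _ _ _ _ fdf); split.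
    by move=> a u v; rewrite linearP.
  by apply: diff_continuous; exact: ex_diff.
have fgx := nbhs_singleton fg.
move/(is_diffP _ _ dl dc) : fdf => h; apply/(is_diffP _ _ dl dc) => e e0.
by near=> y; rewrite -fgx -(near fg y)//; near: y; exact: h.
Unshelve. all: by end_near. Qed.

Lemma near_eq_differentiable V W (f g : V -> W) (x : V) :
  (\forall y \near x, f y = g y) -> differentiable f x -> differentiable g x.
Proof. by move=> fg /differentiableP /(is_diff_near fg) []. Qed.

Lemma near_eq_diff V W (f g : V -> W) (x : V) :
  (\forall y \near x, f y = g y) -> differentiable f x ->
  'd g x = 'd f x :> (V -> W).
Proof. by move=> fg /differentiableP /(is_diff_near fg) []. Qed.

Lemma is_diff_linear V W (l : V -> W) (x : V) : linear l -> continuous l ->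
  is_diff x l l.
Proof.
move=> ll lc; apply/is_diffP => // e e0; near=> y.
pose lL : {linear V -> W} := HB.pack l (GRing.isLinear.Build _ _ _ _ _ ll).
have -> : l (y - x) = l y - l x by exact: (raddfB lL).
by rewrite subrr normr0 mulr_ge0// ltW.
Unshelve. all: by end_near. Qed.

Lemma scale_is_bilinear V :
  bilinear_for
    (GRing.Scale.Law.clone _ _ *:%R _) (GRing.Scale.Law.clone _ _ *:%R _)
    (@GRing.scale R V : R -> V -> V).
Proof.
split=> [u'|u] a x y /=.
- by rewrite scalerDl -scalerA.
- by rewrite scalerDr !scalerA mulrC.
Qed.

Lemma is_diff_scale V W (k dk : V -> R) (f df : V -> W) (x : V) :
  is_diff x k dk -> is_diff x f df ->
  is_diff x (fun y => k y *: f y) (fun v => k x *: df v + dk v *: f x).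
Proof.
move=> hk hf.
pose sc : {bilinear R -> W -> W} :=
  HB.pack (@GRing.scale R W : R -> W -> W)
   (bilinear_isBilinear.Build _ _ _ _ _ _ _ (scale_is_bilinear W)).
have cont : continuous (fun q : R * W => sc q.1 q.2).
  exact: scale_continuous.
have hs : is_diff (k x, f x) (fun q : R * W => sc q.1 q.2)
    (fun q => sc (k x) q.2 + sc q.1 (f x)).
  by apply: DiffDef; [exact: differentiable_bilin|rewrite diff_bilin].
have hp : is_diff x (fun y => (k y, f y)) (fun v => (dk v, df v)).
  exact: is_diff_pair.
exact: (@is_diff_comp _ _ _ _ (fun y => (k y, f y)) _ (fun q => sc q.1 q.2) _ _ hp hs).
Qed.

Lemma is_diff_big V W (m : nat) (f df : 'I_m -> V -> W) (x : V) :
  (forall j, is_diff x (f j) (df j)) ->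
  is_diff x (fun y => \sum_j f j y) (fun v => \sum_j df j v).
Proof.
elim: m f df => [|m IH] f df h.
  rewrite (_ : (fun _ => _) = cst 0); last by apply/funext=> y; rewrite big_ord0.
  rewrite (_ : (fun v => _) = 0); first exact: is_diff_cst.
  by apply/funext => v; rewrite big_ord0.
rewrite (_ : (fun _ => _) = (fun y => f ord0 y) + (fun y => \sum_j f (lift ord0 j) y)).
  rewrite (_ : (fun v => \sum_j df j v) =
     (fun y => df ord0 y) + (fun y => \sum_j df (lift ord0 j) y)).
    by apply: is_diffD.
  by apply/funext => v; rewrite big_ord_recl.
by apply/funext => v; rewrite big_ord_recl.
Qed.

Lemma diff_eq V W (f df : V -> W) (x : V) : is_diff x f df ->
  'd f x = df :> (V -> W).
Proof. by case. Qed.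

End differentials.

(** * Spaces with finitely many continuous linear coordinates *)

Section finite_dimension.
Context {R : realType}.
Implicit Types U V W : normedModType R.

(** A spanning family with continuous linear coordinates. This form passes directly to products, and
    it lets a differential be written as a combination of differentials in the fixed directions
    [e j]. *)
Definition finite_dim V := exists (m : nat) (e : 'I_m -> V) (c : 'I_m -> V -> R),
  (forall j, linear (c j) /\ continuous (c j)) /\
  forall v, v = \sum_j c j v *: e j.

Lemma finite_dim_real : finite_dim (R : normedModType R).
Proof.
exists 1%N, (fun=> 1), (fun=> id); split.
  by move=> _; split => // x.
by move=> v; rewrite big_ord1; exact: (esym (mulr1 _)).
Qed.

Lemma finite_dim_row n : finite_dim ('rV[R]_n : normedModType R).
Proof.
exists n, (fun j => delta_mx ord0 j), (fun j (v : 'rV[R]_n) => v ord0 j); split.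
  by move=> j; split=> [a u v|]; [rewrite !mxE|exact: coord_continuous].
exact: row_sum_delta.
Qed.

Lemma finite_dim_prod V W : finite_dim V -> finite_dim W ->
  finite_dim (V * W)%type.
Proof.
move=> [m [e [c [ch ce]]]] [m' [e' [c' [ch' ce']]]].
exists (m + m')%N, (fun j : 'I_(m + m') => match fintype.split j with inl i => (e i, 0) | inr i => (0, e' i) end),
  (fun (j : 'I_(m + m')) z => match fintype.split j with inl i => c i z.1 | inr i => c' i z.2 end).
split.
  move=> j; case: (fintype.split j) => i; split.
  - by move=> a u v /=; rewrite (proj1 (ch i)).
  - move=> x; apply: (@continuous_comp _ _ _ fst (c i)); first exact: cvg_fst.
    exact: (proj2 (ch i)).
  - by move=> a u v /=; rewrite (proj1 (ch' i)).
  - move=> x; apply: (@continuous_comp _ _ _ snd (c' i)); first exact: cvg_snd.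
    exact: (proj2 (ch' i)).
move=> [v w]; rewrite big_split_ord /=.
under eq_bigr do rewrite (unsplitK (inl _)) /=.
under [X in _ + X]eq_bigr do rewrite (unsplitK (inr _)) /=.
have fst_sum k (F : 'I_k -> V * W) : \sum_j F j = (\sum_j (F j).1, \sum_j (F j).2).
  elim: k F => [|k IH] F; first by rewrite !big_ord0.
  by rewrite !big_ord_recl IH.
rewrite !fst_sum /=.
have add_pair (a b : V * W) : a + b = (a.1 + b.1, a.2 + b.2) by [].
rewrite add_pair /= -ce -ce'.
by rewrite !big1 ?addr0 ?add0r// => j _; rewrite scaler0.
Qed.

End finite_dimension.

(** * Calculus of maps of class C^k *)

Section Ck.
Context {R : realType}.
Implicit Types U V W : normedModType R.

Lemma Ck_diff V W k (A : set V) (f : V -> W) v :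
  Ck_on k.+1 A f -> Ck_on k A (fun x => 'd f x v).
Proof. by case=> _; exact. Qed.

Lemma CkW V W k (A : set V) (f : V -> W) : Ck_on k.+1 A f -> Ck_on k A f.
Proof.
elim: k f => [|k IH] f [fd fdd].
  by move=> x /fd; exact: differentiable_continuous.
by split=> // v; exact/IH/fdd.
Qed.

(** [Ck_on] takes continuity and differentials in the whole space and not relative to the set, so it
    is a condition point by point; hence [B] may be any set containing the point. *)
Lemma Ck_local V W k (A : set V) (f : V -> W) :
  (forall x, A x -> exists2 B : set V, B x & Ck_on k B f) -> Ck_on k A f.
Proof.
elim: k f => [|k IH] f h.
  by move=> x /h[B Bx] /(_ x Bx).
split=> [x /h[B Bx] [fd _]|v]; first exact: fd.
by apply: IH => x /h[B Bx [_ fd]]; exists B => //; exact: fd.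
Qed.

Lemma sub_Ck V W k (A B : set V) (f : V -> W) :
  A `<=` B -> Ck_on k B f -> Ck_on k A f.
Proof. by move=> AB Bf; apply: Ck_local => x /AB Bx; exists B. Qed.

Lemma eq_Ck V W k (A : set V) (f g : V -> W) : open A ->
  (forall x, A x -> f x = g x) -> Ck_on k A f -> Ck_on k A g.
Proof.
move=> oA; elim: k f g => [|k IH] f g fg.
  move=> h x Ax; have fgx : \forall y \near x, f y = g y.
    by apply: filterS (open_nbhs_nbhs (conj oA Ax)); exact: fg.
  have := h x Ax; rewrite /prop_for /continuous_at (fg x Ax).
  by apply: cvg_trans; apply: near_eq_cvg; near=> y; rewrite (near fgx y).
have fgx x : A x -> \forall y \near x, f y = g y.
  by move=> Ax; apply: filterS (open_nbhs_nbhs (conj oA Ax)); exact: fg.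
case=> fd fdd; split=> [x Ax|v].
  by apply: near_eq_differentiable (fgx x Ax) (fd x Ax).
apply: IH (fdd v) => x Ax.
by rewrite (near_eq_diff (fgx x Ax) (fd x Ax)).
Unshelve. all: by end_near. Qed.

Lemma Ck_linear V W k (A : set V) (l : V -> W) : open A ->
  linear l -> continuous l -> Ck_on k A l.
Proof.
move=> oA ll lc; case: k => [|k]; first by move=> x _; exact: lc.
have lE x : is_diff x l l by exact: is_diff_linear.
split=> [x _|v]; first exact: (@ex_diff _ _ _ _ _ _ _ (lE x)).
apply: (@eq_Ck _ _ _ _ (fun=> l v)) => //; last exact: Ck_cst.
by move=> x _; rewrite (diff_eq (lE x)).
Qed.

Lemma Ck_linear_comp U V W k (A : set U) (f : U -> V) (l : V -> W) : open A ->
  linear l -> continuous l -> Ck_on k A f -> Ck_on k A (fun x => l (f x)).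
Proof.
move=> oA ll lc; elim: k f => [|k IH] f.
  by move=> h x /h fx; apply: (@continuous_comp _ _ _ f l) => //; exact: lc.
have lE x : is_diff x l l by exact: is_diff_linear.
case=> fd fdd; split=> [x /fd ?|v].
  by apply: (@differentiable_comp _ _ _ _ f l) => //; exact: ex_diff.
apply: eq_Ck (IH _ (fdd v)) => // x Ax.
have fx : is_diff x f ('d f x) by apply/differentiableP; exact: fd.
by rewrite (diff_eq (is_diff_comp fx (lE (f x)))).
Qed.

Lemma CkD V W k (A : set V) (f g : V -> W) : open A ->
  Ck_on k A f -> Ck_on k A g -> Ck_on k A (fun x => f x + g x).
Proof.
move=> oA; elim: k f g => [|k IH] f g.
  by move=> fc gc x Ax; apply: continuousD; [exact: fc|exact: gc].
case=> fd fdd [gd gdd].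
have fgd x : A x -> is_diff x (fun x => f x + g x) (('d f x : V -> W) + 'd g x).
  by move=> Ax; apply: is_diffD; apply/differentiableP; [exact: fd|exact: gd].
split=> [x /fgd[]//|v].
apply: eq_Ck (IH _ _ (fdd v) (gdd v)) => // x Ax.
by rewrite (diff_eq (fgd x Ax)).
Qed.

Lemma Ck_sum V W k (A : set V) m (f : 'I_m -> V -> W) : open A ->
  (forall j, Ck_on k A (f j)) -> Ck_on k A (fun x => \sum_j f j x).
Proof.
move=> oA; elim: m f => [|m IH] f h.
  by rewrite (_ : (fun _ => _) = fun=> 0); [exact: Ck_cst|apply/funext=> x; rewrite big_ord0].
rewrite (_ : (fun _ => _) = (fun x => f ord0 x + \sum_j f (lift ord0 j) x)).
  by apply: CkD => //; apply: IH.
by apply/funext => v; rewrite big_ord_recl.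
Qed.

Lemma CkZ V W k (A : set V) (a : V -> R) (f : V -> W) : open A ->
  Ck_on k A a -> Ck_on k A f -> Ck_on k A (fun x => a x *: f x).
Proof.
move=> oA; elim: k a f => [|k IH] a f.
  by move=> ac fc x Ax; apply: continuousZ; [exact: ac|exact: fc].
move=> ak fk; have [ad add] := ak; have [fd fdd] := fk.
have afd x : A x -> is_diff x (fun x => a x *: f x)
    (fun v => a x *: 'd f x v + 'd a x v *: f x).
  by move=> Ax; apply: is_diff_scale; apply/differentiableP; [exact: ad|exact: fd].
split=> [x /afd[]//|v].
apply: (@eq_Ck _ _ _ _ (fun x => a x *: 'd f x v + 'd a x v *: f x)) => //.
  by move=> x Ax; rewrite (diff_eq (afd x Ax)).
apply: (CkD oA); apply: IH.
- exact: CkW.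
- exact: Ck_diff.
- exact: Ck_diff.
- exact: CkW.
Qed.

Lemma Ck_pair U V W k (A : set U) (f : U -> V) (g : U -> W) : open A ->
  Ck_on k A f -> Ck_on k A g -> Ck_on k A (fun x => (f x, g x)).
Proof.
move=> oA; elim: k f g => [|k IH] f g.
  by move=> fc gc x Ax; apply: cvg_pair; [exact: fc|exact: gc].
move=> [fd fdd] [gd gdd].
have fgd x : A x -> is_diff x (fun x => (f x, g x)) (fun v => ('d f x v, 'd g x v)).
  by move=> Ax; apply: is_diff_pair; apply/differentiableP; [exact: fd|exact: gd].
split=> [x /fgd[]//|v].
apply: eq_Ck (IH _ _ (fdd v) (gdd v)) => // x Ax.
by rewrite (diff_eq (fgd x Ax)).
Qed.

(** By the chain rule the differential of the composite in a direction [v] is ['d g (f x)] in the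
    moving direction ['d f x v]. Expanded in the coordinates of [V], it is a sum of products whose
    factors are of class C^k, by induction with [g] replaced by its differential in a fixed
    direction. *)
Lemma Ck_comp U V W k (A : set U) (B : set V) (f : U -> V) (g : V -> W) :
  finite_dim V -> open A -> (forall x, A x -> B (f x)) ->
  Ck_on k A f -> Ck_on k B g -> Ck_on k A (fun x => g (f x)).
Proof.
move=> [m [e [c [clc ce]]]] oA AB; elim: k f g AB => [|k IH] f g AB.
  move=> fc gc x Ax; apply: (@continuous_comp _ _ _ f g); first exact: fc.
  exact/gc/AB.
move=> fk gk; have [fd fdd] := fk; have [gd gdd] := gk.
split=> [x Ax|v].
  by apply: (@differentiable_comp _ _ _ _ f g); [exact: fd|exact/gd/AB].
apply: (@eq_Ck _ _ _ _ (fun x => \sum_j c j ('d f x v) *: 'd g (f x) (e j))) => //.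
  move=> x Ax.
  have fx : is_diff x f ('d f x) by apply/differentiableP; exact: fd.
  have gfx : is_diff (f x) g ('d g (f x)) by apply/differentiableP; exact/gd/AB.
  rewrite (diff_eq (is_diff_comp fx gfx)) /=.
  rewrite [in RHS](ce ('d f x v)) linear_sum/=.
  by apply: eq_bigr => j _; rewrite linearZ.
apply: Ck_sum => // j; apply: CkZ => //.
  by apply: Ck_linear_comp (fdd v) => //; have [] := clc j.
by apply: (IH f (fun y => 'd g y (e j)) AB); [exact: CkW|exact: Ck_diff].
Qed.

End Ck.

Section smooth.
Context {R : realType}.
Implicit Types U V W : normedModType R.

Lemma smooth_differentiable V W (A : set V) (f : V -> W) x :
  smooth_on A f -> A x -> differentiable f x.
Proof. by move=> /(_ 1%N) [h _]; exact: h. Qed.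

Lemma smooth_continuous V W (A : set V) (f : V -> W) x :
  smooth_on A f -> A x -> {for x, continuous f}.
Proof. by move=> /(_ 0%N) h; exact: h. Qed.

Lemma smooth_diff V W (A : set V) (f : V -> W) v :
  smooth_on A f -> smooth_on A (fun x => 'd f x v).
Proof. by move=> h k; have [_] := h k.+1; exact. Qed.

Lemma smooth_local V W (A : set V) (f : V -> W) :
  (forall x, A x -> smooth_near f x) -> smooth_on A f.
Proof. by move=> h k; apply: Ck_local => x /h [B [_ Bx /(_ k)]]; exists B. Qed.

Lemma sub_smooth V W (A B : set V) (f : V -> W) :
  A `<=` B -> smooth_on B f -> smooth_on A f.
Proof. by move=> AB h k; exact: sub_Ck AB (h k). Qed.

Lemma eq_smooth V W (A : set V) (f g : V -> W) : open A ->
  (forall x, A x -> f x = g x) -> smooth_on A f -> smooth_on A g.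
Proof. by move=> oA fg h k; exact: eq_Ck fg (h k). Qed.

Lemma smooth_cst V W (A : set V) (w : W) : smooth_on A (fun=> w).
Proof. by move=> k; exact: Ck_cst. Qed.

Lemma smooth_linear V W (A : set V) (l : V -> W) : open A ->
  linear l -> continuous l -> smooth_on A l.
Proof. by move=> *; move=> k; exact: Ck_linear. Qed.

Lemma smoothD V W (A : set V) (f g : V -> W) : open A ->
  smooth_on A f -> smooth_on A g -> smooth_on A (fun x => f x + g x).
Proof. by move=> oA fs gs k; exact: CkD. Qed.

Lemma smoothB V W (A : set V) (f g : V -> W) : open A ->
  smooth_on A f -> smooth_on A g -> smooth_on A (fun x => f x - g x).
Proof.
move=> oA fs gs; apply: smoothD => // k.
apply: (@Ck_linear_comp _ _ _ _ _ A g (fun y => - y)) => //.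
  by move=> a u v; rewrite opprD scalerN.
exact: opp_continuous.
Qed.

Lemma smooth_pair U V W (A : set U) (f : U -> V) (g : U -> W) : open A ->
  smooth_on A f -> smooth_on A g -> smooth_on A (fun x => (f x, g x)).
Proof. by move=> oA fs gs k; exact: Ck_pair. Qed.

Lemma smooth_fst U V W (A : set U) (f : U -> V * W) : open A ->
  smooth_on A f -> smooth_on A (fun x => (f x).1).
Proof.
move=> oA fs k; apply: (@Ck_linear_comp _ _ _ _ _ A f fst) => //.
by move=> x; exact: cvg_fst.
Qed.

Lemma smooth_comp U V W (A : set U) (B : set V) (f : U -> V) (g : V -> W) :
  finite_dim V -> open A -> (forall x, A x -> B (f x)) ->
  smooth_on A f -> smooth_on B g -> smooth_on A (fun x => g (f x)).
Proof. by move=> fdV oA AB fs gs k; exact: (Ck_comp _ _ AB). Qed.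

(* [b] is decomposed in a basis since [smooth_on] only concerns the differential
   of [g] in fixed directions. *)
Lemma smooth_diff_comp U V W (A : set U) (B : set V) (f b : U -> V) (g : V -> W) :
  finite_dim V -> open A -> (forall x, A x -> B (f x)) ->
  smooth_on A f -> smooth_on A b -> smooth_on B g ->
  smooth_on A (fun x => 'd g (f x) (b x)).
Proof.
move=> fdV oA AB fs bs gs; have [m [e [c [clc ce]]]] := fdV.
rewrite (_ : (fun _ => _) = fun x => \sum_j c j (b x) *: 'd g (f x) (e j)).
  move=> k; apply: Ck_sum => // j; apply: CkZ => //.
    by apply: Ck_linear_comp (bs k) => //; have [] := clc j.
  apply: (@smooth_comp _ _ _ A B f (fun y => 'd g y (e j))) => //.
  exact: smooth_diff.
apply/funext => x; rewrite {1}(ce (b x)) linear_sum/=.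
by apply: eq_bigr => j _; rewrite linearZ.
Qed.

(** The product rule for a differential whose base point and direction both vary. It serves to
    differentiate the momentum in time and in the initial condition. *)
Lemma is_diff_diff_comp U V W (B : set V) (f df b db : U -> V)
    (g : V -> W) (x : U) :
  finite_dim V -> B (f x) -> smooth_on B g ->
  is_diff x f df -> is_diff x b db ->
  is_diff x (fun y => 'd g (f y) (b y))
    (fun u => 'd (fun y => 'd g y (b x)) (f x) (df u) + 'd g (f x) (db u)).
Proof.
move=> fdV Bfx gs hf hb; have [m [e [c [clc ce]]]] := fdV.
have dgE y v : 'd g y v = \sum_j c j v *: 'd g y (e j).
  rewrite {1}(ce v) linear_sum/=.
  by apply: eq_bigr => j _; rewrite linearZ.
have gj j : is_diff (f x) (fun y => 'd g y (e j)) ('d (fun y => 'd g y (e j)) (f x)).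
  apply/differentiableP; apply: (@smooth_differentiable _ _ B) => //.
  exact: smooth_diff.
have cj j y : is_diff y (c j) (c j) by apply: is_diff_linear; have [] := clc j.
have -> : (fun y => 'd g (f y) (b y)) =
    (fun y => \sum_j c j (b y) *: 'd g (f y) (e j)).
  by apply/funext => y; rewrite dgE.
have -> : 'd (fun y => 'd g y (b x)) (f x) =
    (fun w => \sum_j c j (b x) *: 'd (fun y => 'd g y (e j)) (f x) w) :> (V -> W).
  have -> : (fun y => 'd g y (b x)) = fun y => \sum_j c j (b x) *: 'd g y (e j).
    by apply/funext => y; rewrite dgE.
  apply: diff_eq.
  apply: (@is_diff_big _ _ _ _ (fun j y => c j (b x) *: 'd g y (e j))
    (fun j w => c j (b x) *: 'd (fun y => 'd g y (e j)) (f x) w)).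
have hj j : is_diff x (fun y => c j (b y) *: 'd g (f y) (e j))
    (fun u => c j (b x) *: 'd (fun y => 'd g y (e j)) (f x) (df u) +
       c j (db u) *: 'd g (f x) (e j)).
  exact: (is_diff_scale (is_diff_comp hb (cj j _)) (is_diff_comp hf (gj j))).
apply: (is_diff_eq (is_diff_big hj)).
apply/funext => u /=; rewrite dgE -big_split/=.
by apply: eq_bigr => j _.
Qed.

End smooth.

(** * Symmetry of the second differential *)

Section second_differential.
Context {R : realType}.
Implicit Types V W : normedModType R.

Lemma is_diff_derive V (f : R -> V) (df : R -> V) (t : R) :
  is_diff t f df -> is_derive t 1 f (df 1).
Proof.
move=> h; have fd : differentiable f t by case: h.
by apply: DeriveDef; [exact: diff_derivable|rewrite deriveE// (diff_eq h)].
Qed.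

Lemma is_diff_derive1 V (f : R -> V) (df : R -> V) (t : R) :
  is_diff t f df -> derive1 f t = df 1.
Proof. by move=> /is_diff_derive h; rewrite derive1E derive_val. Qed.

Lemma is_diff_line V (u w : V) (t : R) :
  is_diff t (fun s : R => s *: u + w) (fun s : R => s *: u).
Proof.
rewrite -[X in is_diff _ _ X]addr0.
exact: (@is_diffD _ _ _ (fun s : R => s *: u) (cst w)).
Qed.

Let second_difference V (f : V -> R) (x u v : V) :=
  f (u + v + x) - f (u + x) - f (v + x) + f x.

(** The mean value theorem in the direction [u] turns the second difference into [h] times a
    difference of two values of ['d f _ u], and each is compared with the linearisation of
    ['d f _ u] at [x]. The errors add up to at most e h^2 (2|u| + |v|); the bound is enlarged to be
    symmetric in [u] and [v]. *)
Let second_difference_estimate V (A : set V) (f : V -> R) (x u v : V) (e : R) :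
  open A -> A x -> smooth_on A f -> 0 < e ->
  \forall h \near 0^'+,
    `|second_difference f x (h *: u) (h *: v)
      - h ^+ 2 * 'd (fun y => 'd f y u) x v|
    <= e * (h ^+ 2 * (2 * (`|u| + `|v|))).
Proof.
move=> oA Ax fs e0.
pose Du y := 'd f y u.
have dDu : is_diff x Du ('d Du x).
  by apply/differentiableP; apply: (smooth_differentiable (smooth_diff u fs)).
have est : \forall y \near x, `|Du y - Du x - 'd Du x (y - x)| <= e * `|y - x|.
  move/is_diffP : dDu; apply => //; first by move=> a y z; rewrite linearP.
  by apply: diff_continuous; exact: (smooth_differentiable (smooth_diff u fs)).
have : \forall y \near x, A y /\ `|Du y - Du x - 'd Du x (y - x)| <= e * `|y - x|.
  by apply: filterI est; exact: open_nbhs_nbhs.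
move=> /nbhs_ballP[r /= r0] rP.
have rP' y : `|y| < r ->
    A (y + x) /\ `|Du (y + x) - Du x - 'd Du x y| <= e * `|y|.
  move=> yr; have := rP (y + x); rewrite addrK; apply.
  by rewrite -ball_normE /= opprD addrCA subrr addr0 normrN.
(* The added 1 allows a division even when both directions vanish. *)
have N0 : 0 < `|u| + `|v| + 1 by rewrite ltr_wpDl// addr_ge0.
near=> h.
have h0 : 0 < h by [].
have hr : h * (`|u| + `|v| + 1) < r.
  by rewrite -ltr_pdivlMr//; near: h; apply: nbhs_right_lt; rewrite divr_gt0.
have small s w : 0 <= s <= h -> `|w| <= h * `|v| -> `|s *: u + w| < r.
  move=> /andP[s0 sh] wh; apply: le_lt_trans (ler_normD _ _) _.
  rewrite normrZ ger0_norm//; apply: le_lt_trans hr.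
  have : s * `|u| <= h * `|u| by apply: ler_wpM2r.
  rewrite !mulrDr; lra.
pose phi s := f (s *: u + (h *: v + x)) - f (s *: u + x).
pose dphi s := Du (s *: u + (h *: v + x)) - Du (s *: u + x).
have hv : `|h *: v| <= h * `|v| by rewrite normrZ gtr0_norm.
have z0 : `|0 : V| <= h * `|v| by rewrite normr0 mulr_ge0// ltW.
have phid s : 0 <= s <= h -> is_derive s 1 phi (dphi s).
  move=> sh.
  have fdl w : `|w| <= h * `|v| ->
      is_derive s 1 (fun s => f (s *: u + (w + x))) (Du (s *: u + (w + x))).
    move=> wh.
    have fd : is_diff (s *: u + (w + x)) f ('d f (s *: u + (w + x))).
      apply/differentiableP; apply: (smooth_differentiable fs).
      by have [] := rP' _ (small _ _ sh wh); rewrite addrA.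
    have := is_diff_derive (is_diff_comp (is_diff_line u (w + x) s) fd).
    by rewrite /= scale1r.
  rewrite /phi /dphi.
  have := fdl 0 z0; rewrite add0r => h2.
  exact: is_deriveB (fdl _ hv) h2.
have [||c] := MVT h0 (f := phi) (df := dphi).
- move=> s; rewrite in_itv/= => /andP[s0 sh]; apply: phid.
  by rewrite !ltW.
- apply: derivable_within_continuous => s; rewrite in_itv/= => sh.
  by have [] := phid s sh.
rewrite in_itv/= => /andP[c0 ch] phiE.
have -> : second_difference f x (h *: u) (h *: v) = phi h - phi 0.
  rewrite /phi /second_difference scale0r !add0r addrA opprB; lra.
rewrite {}phiE subr0.
have ch' : 0 <= c <= h by rewrite !ltW.
have [_ E1] := rP' _ (small c _ ch' hv).
have [_ E2] := rP' _ (small c _ ch' z0).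
rewrite addr0 in E2; rewrite -(addrA (c *: u)) in E1.
have -> : dphi c * h - h ^+ 2 * 'd (fun y => 'd f y u) x v =
  h * ((Du (c *: u + (h *: v + x)) - Du x - 'd Du x (c *: u + h *: v)) -
       (Du (c *: u + x) - Du x - 'd Du x (c *: u))).
  have -> : 'd Du x (c *: u + h *: v) = 'd Du x (c *: u) + h * 'd Du x v.
    by rewrite linearD [X in _ + X]linearZ.
  rewrite /dphi -/Du expr2.
  set a := Du _; set b := Du _; set d := Du _; set p := 'd Du x _.
  set q := 'd Du x _; lra.
rewrite normrM (gtr0_norm h0) [leRHS](_ : _ = h * (e * (h * (2 * (`|u| + `|v|))))); last first.
  by rewrite expr2; ring.
apply: ler_wpM2l; first exact: ltW.
apply: le_trans (ler_normB _ _) _.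
apply: le_trans (lerD E1 E2) _.
rewrite -mulrDr; apply: ler_wpM2l; first exact: ltW.
have : `|c *: u + h *: v| <= `|c *: u| + `|h *: v| by exact: ler_normD.
rewrite !normrZ !gtr0_norm//.
have : c * `|u| <= h * `|u| by rewrite ler_wpM2r// ltW.
have : 0 <= h * `|v| by rewrite mulr_ge0// ltW.
rewrite mulrA mulrDr; lra.
Unshelve. all: by end_near. Qed.

(** The second difference is symmetric in its two increments, and divided by h^2 it is close to
    either iterated differential. *)
Let diff2_sym_real V (A : set V) (f : V -> R) (x u v : V) :
  open A -> A x -> smooth_on A f ->
  'd (fun y => 'd f y u) x v = 'd (fun y => 'd f y v) x u.
Proof.
move=> oA Ax fs; set a := LHS; set b := RHS.
apply/eqP; rewrite -subr_eq0 -normr_le0; apply/ler_addgt0Pr => e e0.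
rewrite add0r.
pose C := 2 * (`|u| + `|v|).
have C0 : 0 <= C by rewrite mulr_ge0// addr_ge0.
(* Two estimates with error e' h^2 C are subtracted, so 2 C e' has to be at most e; the 1 keeps the
   denominator positive. *)
pose e' := e / (2 * C + 1).
have e'0 : 0 < e' by rewrite divr_gt0// ltr_wpDl// mulr_ge0.
have := second_difference_estimate u v oA Ax fs e'0.
have := second_difference_estimate v u oA Ax fs e'0.
rewrite -/a -/b [`|v| + _]addrC -/C => h1 h2.
have [h [[h0 H1] H2]] : exists h : R, (0 < h /\
   `|second_difference f x (h *: v) (h *: u) - h ^+ 2 * b| <= e' * (h ^+ 2 * C)) /\
   `|second_difference f x (h *: u) (h *: v) - h ^+ 2 * a| <= e' * (h ^+ 2 * C).
  apply: (@filter_ex _ (0^'+) _).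
  by near=> h; repeat split => //; near: h.
have dsym : second_difference f x (h *: v) (h *: u) =
            second_difference f x (h *: u) (h *: v).
  by rewrite /second_difference [h *: v + h *: u]addrC; lra.
rewrite dsym in H1.
have : `|h ^+ 2 * (a - b)| <= h ^+ 2 * (e' * (2 * C)).
  set s := second_difference _ _ _ _ in H1 H2.
  have -> : h ^+ 2 * (a - b) = (s - h ^+ 2 * b) - (s - h ^+ 2 * a) by lra.
  apply: le_trans (ler_normB _ _) _; apply: le_trans (lerD H1 H2) _.
  by rewrite le_eqVlt; apply/orP; left; apply/eqP; lra.
rewrite normrM ger0_norm ?sqr_ge0// ler_pM2l ?exprn_gt0// => /le_trans; apply.
rewrite /e' mulrAC ler_pdivrMr ?ltr_wpDl ?mulr_ge0//.
by apply: ler_wpM2l; [exact: ltW|rewrite lerDl].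
Unshelve. all: by end_near. Qed.

Lemma diff2_sym V W (A : set V) (f : V -> W) (x u v : V) :
  finite_dim W -> open A -> A x -> smooth_on A f ->
  'd (fun y => 'd f y u) x v = 'd (fun y => 'd f y v) x u.
Proof.
move=> [m [e [c [clc ce]]]] oA Ax fs.
have cE j (g : V -> W) y w : differentiable g y ->
    c j ('d g y w) = 'd (fun z => c j (g z)) y w.
  move=> /differentiableP dg; have [cl cc] := clc j.
  by rewrite (diff_eq (is_diff_comp dg (is_diff_linear (g y) cl cc))).
have cs j : smooth_on A (fun z => c j (f z)).
  have [cl cc] := clc j.
  by move=> k; exact: (Ck_linear_comp oA cl cc (fs k)).
have c2 j a b : c j ('d (fun y => 'd f y a) x b) =
    'd (fun y => 'd (fun z => c j (f z)) y a) x b.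
  rewrite cE; last exact: (smooth_differentiable (smooth_diff a fs)).
  apply: (congr1 (@^~ b)); apply: near_eq_diff; last first.
    exact: (smooth_differentiable (smooth_diff a (cs j))).
  apply: filterS (open_nbhs_nbhs (conj oA Ax)) => y Ay.
  by rewrite -cE//; exact: (smooth_differentiable fs).
rewrite [LHS]ce [RHS]ce; apply: eq_bigr => j _; rewrite !c2.
by rewrite (diff2_sym_real u v oA Ax (cs j)).
Qed.

End second_differential.

(** * Integrals depending on a parameter *)

Section oriented_integral.
Context {R : realType}.
Implicit Types (a b : R) (f g : R -> R).
Local Notation mu := (@lebesgue_measure R).

Lemma integrable_segment a b f : continuous f ->
  mu.-integrable `[a, b] (EFin \o f).
Proof.
move=> fc; apply: continuous_compact_integrable; first exact: segment_compact.
exact: continuous_subspaceT.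
Qed.

Lemma Rintegral_FTC a b (f F : R -> R) : a <= b -> continuous f ->
  (forall s : R, is_derive s (1 : R) F (f s)) ->
  \int[mu]_(x in `[a, b]) f x = F b - F a.
Proof.
rewrite le_eqVlt => /predU1P[<-|ab] fc Ff.
  by rewrite set_itv1 Rintegral_set1 subrr.
have Fd (s : R) : derivable F s 1 by case: (Ff s).
have Fc : continuous F.
  by move=> s; apply/differentiable_continuous/derivable1_diffP/Fd.
rewrite /Rintegral (@continuous_FTC2 _ f F)//.
- exact: continuous_subspaceT.
- split=> //.
    by apply: cvg_at_right_filter; exact: Fc.
  by apply: cvg_at_left_filter; exact: Fc.
- by move=> s _; rewrite derive1E derive_val.
Qed.

Lemma oriented_integral_FTC a b (f F : R -> R) : continuous f ->
  (forall s : R, is_derive s (1 : R) F (f s)) ->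
  oriented_integral a b f = F b - F a.
Proof.
move=> fc Ff; rewrite /oriented_integral; case: ifPn => [ab|].
  exact: Rintegral_FTC.
rewrite -ltNge => /ltW ba.
by rewrite (Rintegral_FTC ba fc Ff) opprB.
Qed.

Lemma oriented_integralP a b f g k : continuous f -> continuous g ->
  oriented_integral a b (fun s => k * f s + g s) =
  k * oriented_integral a b f + oriented_integral a b g.
Proof.
move=> fc gc; have kfc : continuous (fun s => k * f s).
  by move=> s; apply: continuousM; [exact: cst_continuous|exact: fc].
have h c d : \int[mu]_(s in `[c, d]) (k * f s + g s) =
    k * \int[mu]_(s in `[c, d]) f s + \int[mu]_(s in `[c, d]) g s.
  rewrite RintegralD//; [|exact: integrable_segment..].
  by rewrite RintegralZl//; exact: integrable_segment.
rewrite /oriented_integral; case: ifP => _; rewrite h//.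
by rewrite opprD mulrN.
Qed.

Lemma oriented_integralB a b f g : continuous f -> continuous g ->
  oriented_integral a b (fun s => f s - g s) =
  oriented_integral a b f - oriented_integral a b g.
Proof.
move=> fc gc; rewrite [RHS]addrC -mulN1r -oriented_integralP//.
by congr oriented_integral; apply/funext => s; rewrite mulN1r addrC.
Qed.

(** A bound on the symmetric range |s| <= |t| serves both signs of [t], so users of the estimate
    need no case distinction. *)
Lemma oriented_integral_le (t : R) f (M : R) : continuous f ->
  (forall s, `|s| <= `|t| -> `|f s| <= M) ->
  `|oriented_integral 0 t f| <= M * `|t|.
Proof.
move=> fc fM.
have h c d : c <= d -> (forall s, c <= s <= d -> `|f s| <= M) ->
    `|\int[mu]_(s in `[c, d]) f s| <= M * (d - c).
  move=> cd cdM.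
  apply: le_trans (le_normr_Rintegral _ _) _ => //; first exact: integrable_segment.
  have -> : M * (d - c) = \int[mu]_(s in `[c, d]) (cst M s).
    rewrite Rintegral_cst//= lebesgue_measure_itv/= lte_fin.
    by case: ltgtP cd => //= -> _; rewrite subrr mulr0.
  apply: le_Rintegral => //.
  - apply: (@integrable_segment c d (fun s => `|f s|)) => s.
    by apply: continuous_comp; [exact: fc|exact: norm_continuous].
  - by apply: integrable_segment => s; exact: cst_continuous.
rewrite /oriented_integral; case: ifPn => [t0|].
  apply: le_trans (h _ _ t0 _) _; last by rewrite subr0 ger0_norm.
  by move=> s /andP[s0 st]; apply: fM; rewrite !ger0_norm.
rewrite -ltNge => t0; rewrite normrN.
apply: le_trans (h _ _ (ltW t0) _) _; last by rewrite sub0r ltr0_norm.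
by move=> s /andP[s0 st]; apply: fM; rewrite ler0_norm// ltr0_norm// lerN2.
Qed.

End oriented_integral.

Section parameter.
Context {R : realType} (V : normedModType R) (A : set V).
Hypotheses (oA : open A) (fdV : finite_dim V).
Implicit Types (g : V * R -> R) (x y : V) (s t : R).
Local Notation AR := (A `*` [set: R]).

Lemma parameter_continuous g x : (forall z, AR z -> {for z, continuous g}) ->
  A x -> continuous (fun s => g (x, s)).
Proof.
move=> gc Ax s; apply: (@continuous_comp _ _ _ (fun s => (x, s)) g).
  by apply/differentiable_continuous/differentiable_pair; exact: ex_diff.
exact: (gc (x, s) (conj Ax I)).
Qed.

(** A tube argument: continuity at each [(x, s)] gives a neighbourhood of [x] depending on [s], and
    compactness of [-|t|, |t|] makes it uniform. *)
Lemma parameter_uniform g x t (e : R) :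
  (forall z, AR z -> {for z, continuous g}) -> A x -> 0 < e ->
  \forall y \near x, forall s, `|s| <= `|t| -> `|g (y, s) - g (x, s)| <= e.
Proof.
move=> gc Ax e0.
have /compact_near_coveringP cK : compact `[- `|t|, `|t|]%classic.
  exact: segment_compact.
have : \forall y \near x, `[- `|t|, `|t|]%classic `<=`
    (fun s => `|g (y, s) - g (x, s)| <= e).
  apply: cK => s _.
  (* Half of [e], because [g (y, s')] and [g (x, s')] are both compared with [g (x, s)]. *)
  have /cvgrPdist_le/(_ (e / 2)) :
    g z @[z --> (x, s)] --> g (x, s).
    exact: (gc (x, s) (conj Ax I)).
  rewrite divr_gt0// => /(_ isT) [[B1 B2] /= [Bx Bs] Bg].
  exists (B2, B1) => //= -[s' y] /= [Bs' By].
  have h1 := Bg (y, s') (conj By Bs').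
  have h2 := Bg (x, s') (conj (nbhs_singleton Bx) Bs').
  rewrite /= in h1 h2.
  rewrite -[X in `|X|](subrKA (g (x, s))) [e]splitr.
  by apply: le_trans (ler_normD _ _) _; rewrite lerD// distrC.
by apply: filterS => y h s st; apply: h; rewrite /= in_itv/= -ler_norml.
Qed.

Lemma parameter_integral_continuous g t x :
  (forall z, AR z -> {for z, continuous g}) -> A x ->
  {for x, continuous (fun x => oriented_integral 0 t (fun s => g (x, s)))}.
Proof.
move=> gc Ax; apply/cvgrPdist_le => e e0.
have T0 : 0 < `|t| + 1 by rewrite ltr_wpDl.
(* The pointwise bound is integrated over a length |t|; the 1 covers [t = 0]. *)
have e'0 : 0 < e / (`|t| + 1) by rewrite divr_gt0.
near=> y.
have Ay : A y by near: y; exact: open_nbhs_nbhs.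
have gx := parameter_continuous gc Ax; have gy := parameter_continuous gc Ay.
rewrite -oriented_integralB//.
apply: (@le_trans _ _ (e / (`|t| + 1) * `|t|)).
  apply: oriented_integral_le.
    by move=> s; apply: continuousB; [exact: gx|exact: gy].
  move=> s st; rewrite distrC.
  by move: s st; near: y; exact: parameter_uniform.
by rewrite mulrAC ler_pdivrMr//; apply: ler_wpM2l; [exact: ltW|rewrite lerDl].
Unshelve. all: by end_near. Qed.

(** Along the segment from [x] to [y] the mean value theorem bounds the remainder at each [s] by a
    variation of ['d g]. Only the finitely many directions [(b j, 0)] matter, and there
    [parameter_uniform] makes the variation small for all [s] at once. *)
Lemma parameter_integral_is_diff g t x : Ck_on 1 AR g -> A x ->
  is_diff x (fun x => oriented_integral 0 t (fun s => g (x, s)))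
    (fun v => oriented_integral 0 t (fun s => 'd g (x, s) (v, 0))).
Proof.
move=> gk Ax; have [gd gdd] := gk.
have [m [b [c [clc cb]]]] := fdV.
have gc z : AR z -> {for z, continuous g}.
  by move=> /gd /differentiable_continuous.
have pc y v : A y -> continuous (fun s => 'd g (y, s) (v, 0)).
  by apply: (parameter_continuous (gdd (v, 0))).
have dgE z v : 'd g z (v, 0) = \sum_j c j v * 'd g z (b j, 0).
  have pl : linear (fun v => 'd g z (v, 0)).
    move=> k u w; rewrite -linearP; congr ('d g z _).
    by congr pair; rewrite /= scaler0 addr0.
  pose L : {linear V -> R} := HB.pack (fun v => 'd g z (v, 0))
    (GRing.isLinear.Build _ _ _ _ _ pl).
  rewrite -[LHS]/(L v) {1}(cb v) linear_sum/=.
  by apply: eq_bigr => j _; rewrite -[LHS]/(L _) linearZ.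
have dl : linear (fun v => oriented_integral 0 t (fun s => 'd g (x, s) (v, 0))).
  move=> k u v.
  apply: (etrans _ (oriented_integralP 0 t k (pc x u Ax) (pc x v Ax))).
  congr oriented_integral; apply/funext => s.
  rewrite -[k * _]/(k *: _) -linearP; congr ('d g _ _).
  by congr pair; rewrite /= scaler0 addr0.
(* Being linear, the candidate is a finite combination of the continuous coordinates [c j]. *)
have dc : continuous (fun v => oriented_integral 0 t (fun s => 'd g (x, s) (v, 0))).
  pose L : {linear V -> R} := HB.pack
    (fun v => oriented_integral 0 t (fun s => 'd g (x, s) (v, 0)))
    (GRing.isLinear.Build _ _ _ _ _ dl).
  have LE v : L v = \sum_j c j v *: L (b j).
    by rewrite {1}(cb v) linear_sum/=; apply: eq_bigr => j _; rewrite -[LHS]/(L _) linearZ.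
  have : Ck_on 0 setT (fun v => \sum_j c j v *: L (b j)).
    apply: Ck_sum => [|j]; first exact: openT.
    apply: CkZ; first exact: openT.
      by move=> y _; have [_] := clc j; exact.
    exact: Ck_cst.
  move=> h v; have := h v I; rewrite (_ : (fun v => _) = L)//.
  by apply/funext => w; rewrite LE.
apply/is_diffP => // e e0.
have cj j : exists2 k, k > 0 & forall v, `|c j v| <= k * `|v|.
  have [cl cc] := clc j.
  pose cL : {linear V -> R} := HB.pack (c j) (GRing.isLinear.Build _ _ _ _ _ cl).
  have /linear_lipschitz [k k0 kP] : continuous cL by exact: cc.
  by exists k => // v; exact: kP.
have {cj}[k kP] := choice (fun j => (let: ex_intro2 k k0 kP := cj j in
  ex_intro (fun k => k > 0 /\ forall v, `|c j v| <= k * `|v|) k (conj k0 kP))).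
(* Since |c j (y - x)| <= k j |y - x|, partial differentials within e' of each other give a
   remainder of at most e' C |y - x| at each [s], hence e' C |y - x| |t| after integration. This
   dictates the choice of [e']. *)
pose C := \sum_j k j.
have C0 : 0 <= C by apply: sumr_ge0 => j _; rewrite ltW//; case: (kP j).
have D0 : 0 < C * `|t| + 1 by rewrite ltr_wpDl// mulr_ge0.
pose e' := e / (C * `|t| + 1).
have e'0 : 0 < e' by rewrite divr_gt0.
have : \forall y \near x, A y /\ forall j s, `|s| <= `|t| ->
    `|'d g (y, s) (b j, 0) - 'd g (x, s) (b j, 0)| <= e'.
  apply: filterI; first exact: open_nbhs_nbhs.
  apply: filter_forall => j.
  exact: (@parameter_uniform (fun z => 'd g z (b j, 0)) x t e' (gdd (b j, 0)) Ax e'0).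
move=> /nbhs_ballP[r /= r0 rP].
near=> y.
have xy : ball x r y by near: y; exact: nbhsx_ballx.
have Ay : A y by case: (rP y xy).
have seg s : 0 <= s <= 1 -> ball x r (s *: (y - x) + x).
  move=> /andP[s0 s1]; move: xy; rewrite -!ball_normE /= opprD addrCA subrr addr0.
  rewrite normrN normrZ (ger0_norm s0) distrC; apply: le_lt_trans.
  by rewrite ler_piMl.
have gx := parameter_continuous gc Ax; have gy := parameter_continuous gc Ay.
have gyx : continuous (fun s => g (y, s) - g (x, s)).
  by move=> s; apply: continuousB; [exact: gy|exact: gx].
rewrite -!oriented_integralB//; last exact: pc.
apply: (@le_trans _ _ (e' * C * `|y - x| * `|t|)); last first.
  rewrite mulrAC; apply: ler_wpM2r => //.
  have -> : e' * C * `|t| = e * (C * `|t|) / (C * `|t| + 1) by rewrite /e'; ring.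
  rewrite ler_pdivrMr//.
  by apply: ler_wpM2l; [exact: ltW|rewrite lerDl].
apply: oriented_integral_le.
  move=> s; apply: (@continuousB _ _ _ (fun s => g (y, s) - g (x, s))
    (fun s => 'd g (x, s) (y - x, 0))); [exact: gyx|exact: pc].
move=> s st.
pose phi u := g (u *: (y - x) + x, s).
pose dphi u := 'd g (u *: (y - x) + x, s) (y - x, 0).
have phid (u : R) : 0 <= u <= 1 -> is_derive u (1 : R) phi (dphi u).
  move=> u01; have [Au _] := rP _ (seg u u01).
  have hl : is_diff u (fun u => (u *: (y - x) + x, s)) (fun u => (u *: (y - x), 0)).
    by apply: (is_diff_pair (is_diff_line (y - x) x u)); exact: is_diff_cst.
  have hg : is_diff (u *: (y - x) + x, s) g ('d g (u *: (y - x) + x, s)).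
    by apply/differentiableP; exact: gd.
  have := is_diff_derive (is_diff_comp hl hg).
  by rewrite /= scale1r.
have [||u] := MVT ltr01 (f := phi) (df := dphi).
- by move=> u; rewrite in_itv/= => /andP[u0 u1]; apply: phid; rewrite !ltW.
- apply: derivable_within_continuous => u; rewrite in_itv/= => u01.
  by have [] := phid u u01.
rewrite in_itv/= => /andP[u0 u1].
rewrite /phi scale1r scale0r add0r subrK subr0 mulr1 => ->.
have -> : dphi u - 'd g (x, s) (y - x, 0) = \sum_j c j (y - x) *
    ('d g (u *: (y - x) + x, s) (b j, 0) - 'd g (x, s) (b j, 0)).
  apply: (etrans (congr2 (fun p q => p - q) (dgE _ _) (dgE _ _))).
  by rewrite -sumrB; apply: eq_bigr => j _; rewrite mulrBr.
apply: le_trans (ler_norm_sum _ _ _) _.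
rewrite /C mulr_sumr mulr_suml; apply: ler_sum => j _.
have [kj0 kjP] := kP j.
have u01 : 0 <= u <= 1 by rewrite !ltW.
have [_ hj] := rP _ (seg u u01).
rewrite normrM -mulrA [e' * _]mulrC.
by apply: ler_pM => //; exact: hj.
Unshelve. all: by end_near. Qed.

(** The differential in a direction [v] is an integral of the same shape, with integrand
    ['d g z (v, 0)], so the induction runs over all [g]. *)
Lemma parameter_integral_Ck k g t : Ck_on k AR g ->
  Ck_on k A (fun x => oriented_integral 0 t (fun s => g (x, s))).
Proof.
elim: k g => [|k IH] g gk.
  by move=> x Ax; exact: parameter_integral_continuous.
have g1 : Ck_on 1 AR g by elim: k gk {IH} => // k IH /CkW.
split=> [x Ax|v].
  exact: (@ex_diff _ _ _ _ _ _ _ (parameter_integral_is_diff t g1 Ax)).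
apply: eq_Ck (IH _ (Ck_diff (v, 0) gk)) => // x Ax.
by rewrite (diff_eq (parameter_integral_is_diff t g1 Ax)).
Qed.

End parameter.

(** * Atlases and tangent bundles *)

Section atlas.
Context {R : realType}.

(** The compatibility axioms over an arbitrary model space, so that they also apply to the tangent
    bundle, modelled on [E * E] and not on a space of row vectors. *)
Record is_atlas (E : normedModType R) (M : charts E) : Prop := IsAtlas {
  atlas_chart_at : forall p : M, dom M (chart_at M p) p ;
  atlas_phiK : forall i (p : M), dom M i p -> psi M i (phi M i p) = p ;
  atlas_open : forall i j : idx M, open (phi M i @` (dom M i `&` dom M j)) ;
  atlas_smooth : forall i j : idx M,
    smooth_on (phi M i @` (dom M i `&` dom M j)) (phi M j \o psi M i) }.

Lemma manifold_is_atlas n (Q : manifold R n) : is_atlas Q.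
Proof.
by split; [exact: chart_atP|exact: phiK|exact: open_overlap|exact: smooth_overlap].
Qed.

End atlas.

Section charts_theory.
Context {R : realType} {E : normedModType R} {M : charts E}.
Implicit Types (aM : is_atlas M) (p : M) (i j : idx M).

Lemma chart_image_open aM i : open (chart_image i : set E).
Proof. by rewrite /chart_image -(setIid (dom M i)); exact: atlas_open. Qed.

Lemma chart_image_phi i p : dom M i p -> chart_image i (phi M i p).
Proof. by move=> pi; exists p. Qed.

Lemma psi_dom aM i x : chart_image i x -> dom M i (psi M i x).
Proof. by move=> [p pi <-]; rewrite atlas_phiK. Qed.

Lemma atlas_psiK aM i x : chart_image i x -> phi M i (psi M i x) = x.
Proof. by move=> [p pi <-]; rewrite (atlas_phiK aM). Qed.

Lemma overlapP aM i j x : (phi M i @` (dom M i `&` dom M j)) x <->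
  chart_image i x /\ dom M j (psi M i x).
Proof.
split=> [[p [pi pj] <-]|[[p pi <-]]].
  by rewrite (atlas_phiK aM)//; split=> //; exact: chart_image_phi.
by rewrite (atlas_phiK aM)// => pj; exists p.
Qed.

(** Transition maps are the chart expressions of the identity; statements on differentials of maps
    thereby specialise to changes of chart. *)
Lemma smooth_at_id aM p : smooth_at (id : M -> M) p.
Proof.
move=> i j pi pj.
have ov : (phi M i @` (dom M i `&` dom M j)) (phi M i p) by exists p.
split.
  apply: filterS (open_nbhs_nbhs (conj (atlas_open aM i j) ov)) => x.
  by move=> /(overlapP aM)[].
exists (phi M i @` (dom M i `&` dom M j)); split => //; first exact: atlas_open.
exact: (atlas_smooth aM i j).
Qed.

(** [mk_tangent] falls back to the zero vector on families that violate the transition rule, so that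
    rule has to be established before components can be read. *)
Lemma mk_tangentE p (u : idx M -> E) : u \in tangent_pred p ->
  mk_tangent p u = u :> (idx M -> E).
Proof. by move=> pu; rewrite /mk_tangent -[LHS]/(val _) insubdK. Qed.

Lemma tangent_change p (u : tangent_space p) i j : dom M i p -> dom M j p ->
  u j = 'd (phi M j \o psi M i) (phi M i p) (u i).
Proof. by have /asboolP[_] := compP u; exact. Qed.

Lemma tangent_ext p i (u v : tangent_space p) : dom M i p -> u i = v i -> u = v.
Proof.
move=> pi uv; apply: val_inj; apply/funext => j /=.
have /asboolP[u0 _] := compP u; have /asboolP[v0 _] := compP v.
have [pj|pj] := pselect (dom M j p); last by rewrite u0// v0.
by rewrite !(tangent_change _ pi pj) uv.
Qed.

Lemma tangent_lin p (a : R) (u v : tangent_space p) i :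
  (a *: u + v) i = a *: u i + v i.
Proof. by []. Qed.

End charts_theory.

Section local_expression.
Context {R : realType} {E F : normedModType R} {M : charts E} {N : charts F}.
Implicit Types (aM : is_atlas M) (aN : is_atlas N) (f : M -> N) (p : M).

Lemma smooth_at_is_diff f p i j : smooth_at f p -> dom M i p -> dom N j (f p) ->
  is_diff (phi M i p) (phi N j \o f \o psi M i) ('d (phi N j \o f \o psi M i) (phi M i p)).
Proof.
move=> fs pi pj; have [_ [U [_ Up Us]]] := fs i j pi pj.
by apply/differentiableP; exact: (smooth_differentiable Us).
Qed.

(* The pushforward of the vector with components [w] in the chart [i]. *)
Lemma push_tangent_pred aN f p i w : psi M i (phi M i p) = p -> smooth_at f p ->
  dom M i p ->
  (fun j => if `[< dom N j (f p) >] then 'd (phi N j \o f \o psi M i) (phi M i p) w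
            else 0) \in tangent_pred (f p).
Proof.
move=> psiK fs pi; apply/asboolP; split=> [j pj|j k pj pk].
  by rewrite (asboolF pj).
rewrite !asboolT//.
have hj := smooth_at_is_diff fs pi pj.
have hjk : is_diff ((phi N j \o f \o psi M i) (phi M i p)) (phi N k \o psi N j)
    ('d (phi N k \o psi N j) (phi N j (f p))).
  rewrite /= psiK; apply/differentiableP.
  apply: (smooth_differentiable (atlas_smooth aN j k)).
  by exists (f p).
have := is_diff_comp hj hjk.
move/is_diff_near => h.
rewrite (diff_eq (h (phi N k \o f \o psi M i) _))//.
have [jn _] := fs i j pi pj.
by apply: filterS jn => x xj /=; rewrite (atlas_phiK aN).
Qed.

(** [differential] is defined through the preferred chart at [p]; the chain rule through the
    transition map to [i] gives the same formula in any chart. *)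
Lemma differentialE aM aN f p (u : tangent_space p) i j : smooth_at f p ->
  dom M i p -> dom N j (f p) ->
  differential f u j = 'd (phi N j \o f \o psi M i) (phi M i p) (u i).
Proof.
move=> fs pi pj; set i0 := chart_at M p; have pi0 : dom M i0 p by exact: atlas_chart_at.
rewrite /differential mk_tangentE; last first.
  by apply: push_tangent_pred => //; exact: (atlas_phiK aM).
rewrite asboolT// -/i0 (tangent_change u pi0 pi).
have hi : is_diff (phi M i0 p) (phi M i \o psi M i0)
    ('d (phi M i \o psi M i0) (phi M i0 p)).
  apply/differentiableP.
  by apply: (smooth_differentiable (atlas_smooth aM i0 i)); exists p.
have hj : is_diff ((phi M i \o psi M i0) (phi M i0 p)) (phi N j \o f \o psi M i)
    ('d (phi N j \o f \o psi M i) (phi M i p)).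
  by rewrite /= (atlas_phiK aM)//; exact: smooth_at_is_diff.
have /is_diff_near h := is_diff_comp hi hj.
rewrite (diff_eq (h (phi N j \o f \o psi M i0) _))//.
have : \forall x \near phi M i0 p, (phi M i0 @` (dom M i0 `&` dom M i)) x.
  by apply: open_nbhs_nbhs; split; [exact: atlas_open|exists p].
by apply: filterS => x [q [q0 qi] <-] /=; rewrite (atlas_phiK aM q0) (atlas_phiK aM qi).
Qed.

End local_expression.

Section tangent_vectors.
Context {R : realType} {E : normedModType R} {M : charts E} (aM : is_atlas M).

Lemma tangent_vectorE p i j w : dom M i p -> dom M j p ->
  tangent_vector i p w j = 'd (phi M j \o psi M i) (phi M i p) w.
Proof.
move=> pi pj; rewrite /tangent_vector mk_tangentE; first by rewrite asboolT.
exact: (push_tangent_pred aM w (atlas_phiK aM pi) (@smooth_at_id _ _ _ aM p) pi).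
Qed.

Lemma tangent_vectorK p i w : dom M i p -> tangent_vector i p w i = w.
Proof.
move=> pi; rewrite tangent_vectorE//.
have /is_diff_near h : is_diff (phi M i p) (id : E -> E) id by exact: is_diff_id.
rewrite (diff_eq (h (phi M i \o psi M i) _))//.
have := open_nbhs_nbhs (conj (chart_image_open aM i) (chart_image_phi pi)).
by apply: filterS => x xi /=; rewrite (atlas_psiK aM).
Qed.

(** The components obey the transition rule because they are the push-forward by [c] of the unit
    vector of the line. *)
Lemma velocityE (c : R -> M) (t : R) i :
  smooth_at (c : vector_charts R -> M) t -> dom M i (c t) ->
  velocity c t i = derive1 (phi M i \o c) t.
Proof.
move=> cs ci; rewrite /velocity mk_tangentE; first by rewrite asboolT.
rewrite (_ : (fun _ => _) = (fun j => if `[< dom M j (c t) >] then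
  'd (phi M j \o c \o psi (vector_charts R) tt) (phi (vector_charts R) tt t) 1 else 0)).
  exact: push_tangent_pred.
apply/funext => j; case: asboolP => // cj.
have h := @smooth_at_is_diff _ _ _ (vector_charts R) M c t tt j cs I cj.
by rewrite (is_diff_derive1 h).
Qed.

End tangent_vectors.

Section tangent_bundle_charts.
Context {R : realType} {E : normedModType R} {M : charts E}.
Hypotheses (fdE : finite_dim E) (aM : is_atlas M).
Local Notation TM := (tangent_bundle M).

Lemma tangent_overlap i j :
  phi TM i @` (dom TM i `&` dom TM j) =
  fst @^-1` (phi M i @` (dom M i `&` dom M j)).
Proof.
apply/seteqP; split=> [_ [v [vi vj] <-]|[x w] /= [p [pi pj] <-]].
  by exists (projT1 v).
exists (existT (@tangent_space _ _ M) p (@tangent_vector _ _ M i p w) : TM); first by split.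
by rewrite /= tangent_vectorK.
Qed.

Lemma tangent_chart_image i : chart_image (i : idx TM) = fst @^-1` (chart_image (i : idx M)).
Proof.
by rewrite /chart_image -(setIid (dom TM i)) tangent_overlap setIid.
Qed.

(** With T a transition map of the base, the one of the bundle is (x, w) |-> (T x, dT(x) w); its
    second component needs the smoothness of a differential in a varying direction. *)
Lemma tangent_bundle_is_atlas : is_atlas TM.
Proof.
split=> [v|i [p u] pi|i j|i j].
- exact: (atlas_chart_at aM (projT1 v)).
- rewrite /= in pi *; rewrite (atlas_phiK aM)//; congr existT.
  by apply: (tangent_ext pi); rewrite tangent_vectorK.
- rewrite tangent_overlap; apply: open_comp; last exact: atlas_open.
  by move=> x _; exact: cvg_fst.
- rewrite tangent_overlap; set A := fst @^-1` _.
  have oA : open A.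
    by apply: open_comp; [move=> x _; exact: cvg_fst|exact: atlas_open].
  have sm := atlas_smooth aM i j.
  have s1 : smooth_on A (fst : E * E -> E).
    by apply: smooth_linear => //; move=> x; exact: cvg_fst.
  have s2 : smooth_on A (snd : E * E -> E).
    by apply: smooth_linear => //; move=> x; exact: cvg_snd.
  apply: (@eq_smooth R (E * E)%type (E * E)%type A (fun z : E * E => ((phi M j \o psi M i) z.1,
    'd (phi M j \o psi M i) (z.1) (z.2)))) => //.
    move=> [x w] [p [pi pj]] /= <-; rewrite /= (atlas_phiK aM)//.
    by rewrite tangent_vectorE.
  apply: smooth_pair => //.
    exact: (@smooth_comp _ _ _ _ A _ fst (phi M j \o psi M i) fdE oA _ s1 sm).
  exact: (@smooth_diff_comp _ _ _ _ A _ fst snd (phi M j \o psi M i) fdE oA _ s1 s2 sm).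
Qed.

Lemma tau_smooth v : smooth_at (tau : TM -> M) v.
Proof.
move=> i j vi vj.
have ov : (fst @^-1` (phi M i @` (dom M i `&` dom M j))) (phi TM i v).
  by exists (tau v).
rewrite -tangent_overlap in ov.
have aT := tangent_bundle_is_atlas.
have oO := atlas_open aT i j.
split.
  by apply: filterS (open_nbhs_nbhs (conj oO ov)) => z /(overlapP aT)[].
exists (phi TM i @` (dom TM i `&` dom TM j)); split=> //.
rewrite tangent_overlap in oO *.
apply: (@smooth_comp _ _ _ _ _ _ fst (phi M j \o psi M i) fdE oO _ _ (atlas_smooth aM i j)) => //.
by apply: smooth_linear => //; move=> x; exact: cvg_fst.
Qed.

Lemma differential_tau v (V : tangent_space (v : TM)) i : dom TM i v ->
  differential (tau : TM -> M) V i = (V i).1.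
Proof.
move=> vi; have aT := tangent_bundle_is_atlas.
rewrite (differentialE aT aM _ (@tau_smooth v) vi)//.
have /is_diff_near h : is_diff (phi TM i v) (fst : E * E -> E) fst.
  by apply: is_diff_linear => //; move=> x; exact: cvg_fst.
rewrite (diff_eq (h (phi M i \o tau \o psi TM i) _))//.
have := open_nbhs_nbhs (conj (chart_image_open aT i) (chart_image_phi vi)).
rewrite tangent_chart_image.
by apply: filterS => z zi /=; rewrite (atlas_psiK aM).
Qed.

End tangent_bundle_charts.

(** * The Lagrangian and the flow in charts *)

Section jet_components.
Context {R : realType} {E : normedModType R} {M : charts E}.

Lemma derive1_shift (V : normedModType R) (f : R -> V) (t : R) :
  derive1 (fun s => f (t + s)) = (fun s => derive1 f (t + s)).
Proof.
apply/funext => s; rewrite /derive1.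
rewrite (_ : (fun h : R => _ *: (f (t + (h + s)) - _)) =
  (fun h => h^-1 *: (f (h + (t + s)) - f (t + s))))//.
by apply/funext => h; rewrite addrCA.
Qed.

(** Smoothness at [t] excludes the default value of [jet2]: the shifted curve s |-> c (t + s) is a
    witness for [is_jet2]. *)
Lemma jet2E (c : R -> M) (t : R) i :
  smooth_at (c : vector_charts R -> M) t -> dom M i (c t) ->
  sval (jet2 c t) i = (derive1 (phi M i \o c) t, derive1 (derive1 (phi M i \o c)) t).
Proof.
move=> cs ci; rewrite /jet2; case: pselect => [h|nh].
  by rewrite /= /jet2_comp asboolT.
exfalso; apply: nh; exists (fun s => c (t + s)); split.
- move=> k j _ /=; rewrite addr0 => cj.
  have [n1 [U [oU Ut Us]]] := cs tt j I cj.
  have tc : continuous (fun s : R => t + s).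
    by move=> s; apply: cvgD; [exact: cvg_cst|exact: cvg_id].
  split.
    have : (fun s : R => t + s) @ 0 --> t + 0 by exact: tc.
    by rewrite addr0 => /(_ _ n1).
  exists ((fun s : R => t + s) @^-1` U); split.
  + by apply: open_comp => // s _; exact: tc.
  + by rewrite /= addr0.
  + apply: (@smooth_comp _ _ _ _ _ U (fun s : R => t + s) (phi M j \o c)
      finite_dim_real _ _ _ Us) => //.
    * by apply: open_comp => // s _; exact: tc.
    * apply: smoothD; [|exact: smooth_cst|].
        by apply: open_comp => // s _; exact: tc.
      apply: smooth_linear => //; last by move=> s.
      by apply: open_comp => // s _; exact: tc.
- by rewrite addr0.
apply/funext => j; rewrite /jet2_comp addr0.
have d2 (f : R -> E) s : derive1n 2 f s = derive1 (derive1 f) s by [].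
have -> : phi M j \o (fun s => c (t + s)) = fun s => (phi M j \o c) (t + s) by [].
by rewrite !d2 !derive1_shift addr0.
Qed.

End jet_components.

Section lagrangian_charts.
Context {R : realType} {E : normedModType R} {M : charts E}.
Hypotheses (fdE : finite_dim E) (aM : is_atlas M).
Local Notation TM := (tangent_bundle M).
Variable L : TM -> R.
Hypothesis sL : smooth_map (L : TM -> vector_charts R).
Let aT : is_atlas TM := tangent_bundle_is_atlas fdE aM.

Definition local_lagrangian (i : idx M) (z : E * E) : R := L (psi TM i z).

Lemma local_lagrangian_smooth i : smooth_on (@chart_image _ _ TM i) (local_lagrangian i).
Proof.
apply: smooth_local => x xi.
have [_] := @sL _ i tt (psi_dom aT xi) I.
by rewrite (atlas_psiK aT).
Qed.

Lemma local_lagrangian_is_diff i x : @chart_image _ _ TM i x ->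
  is_diff x (local_lagrangian i) ('d (local_lagrangian i) x).
Proof.
move=> xi; apply/differentiableP.
exact: (smooth_differentiable (local_lagrangian_smooth i)).
Qed.

Lemma legendreE i (q : M) (v w : tangent_space q) : dom M i q ->
  legendre L v w = 'd (local_lagrangian i) (phi M i q, v i) (0, w i).
Proof.
move=> qi; rewrite /legendre.
have -> : (fun z : R => L (existT _ q (v + z *: w))) =
    local_lagrangian i \o (fun z : R => (phi M i q, z *: w i + v i)).
  apply/funext => z.
  pose vz : TM := existT _ q (v + z *: w).
  have vzi : dom TM i vz by [].
  rewrite -[LHS]/(L vz) -(atlas_phiK aT vzi) [RHS]/=; congr (L (psi TM i (_, _))).
  exact: addrC.
have hl : is_diff (0 : R) (fun z : R => (phi M i q, z *: w i + v i))
    (fun z : R => (0, z *: w i)).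
  exact: (is_diff_pair (is_diff_cst _ _) (is_diff_line _ _ _)).
have im : @chart_image _ _ TM i (phi M i q, 0 *: w i + v i).
  by rewrite tangent_chart_image//; exact: chart_image_phi.
rewrite (is_diff_derive1 (is_diff_comp hl (local_lagrangian_is_diff im))) /=.
by rewrite scale1r scale0r add0r.
Qed.

(** The coordinate formula theta_L = (dL/dq'^k) dq^k: only the base part [(V i).1] enters, placed in
    the fibre slot. *)
Lemma lagrangian_form1E i (v : TM) (V : tangent_space v) : dom TM i v ->
  lagrangian_form1 L V = 'd (local_lagrangian i) (phi TM i v) (0, (V i).1).
Proof.
by move=> vi; rewrite /lagrangian_form1 (legendreE (i := i))// differential_tau.
Qed.

End lagrangian_charts.

(** * The flow map in charts *)

Section flow.
Context {R : realType} {E : normedModType R} {M : charts E}.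
Hypotheses (fdE : finite_dim E) (aM : is_atlas M).
Local Notation TM := (tangent_bundle M).
Variable F : TM -> R -> TM.
Hypothesis sF :
  smooth_map ((fun z => F z.1 z.2) : prod_charts TM (vector_charts R) -> TM).
Let aT : is_atlas TM := tangent_bundle_is_atlas fdE aM.
Let fdT : finite_dim (E * E)%type := finite_dim_prod fdE fdE.
Let fdTR : finite_dim ((E * E) * R)%type := finite_dim_prod fdT finite_dim_real.

Definition flow_rep (i j : idx TM) (z : (E * E) * R) : E * E :=
  phi TM j (F (psi TM i z.1) z.2).

(** One open set of pairs (initial point, time) on which the chart expression is smooth, the initial
    point is in the image of [i] and the flow stays in [j]. Near identities used later are proved on
    it. *)
Lemma flow_chart v (s : R) i j : dom TM i v -> dom TM j (F v s) ->
  exists U : set ((E * E) * R),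
    [/\ open U, U (phi TM i v, s), smooth_on U (flow_rep i j) &
     forall z, U z -> @chart_image _ _ TM i z.1 /\ dom TM j (F (psi TM i z.1) z.2)].
Proof.
move=> vi vj.
have [n1 [U [oU Ux Us]]] := @sF (v, s) (i, tt) j (conj vi I) vj.
have oI := chart_image_open aT i.
exists (U `&` (fst @^-1` @chart_image _ _ TM i) `&`
  interior [set z | dom TM j (F (psi TM i z.1) z.2)]); split.
- apply: openI; last exact: open_interior.
  by apply: openI => //; apply: open_comp => // z _; exact: cvg_fst.
- by split => //; split => //; exact: chart_image_phi.
- by apply: sub_smooth Us => z [[]].
- by move=> z [[_ zi] /interior_subset].
Qed.

Lemma time_slice_smooth (U : set ((E * E) * R)) (s : R) : open U ->
  open [set x | U (x, s)] /\ smooth_on [set x | U (x, s)] (fun x : E * E => (x, s)).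
Proof.
move=> oU; have oV : open [set x : E * E | U (x, s)].
  apply: (@open_comp _ _ (fun x : E * E => (x, s))) => // x _.
  by apply/differentiable_continuous/differentiable_pair; exact: ex_diff.
by split => //; apply: smooth_pair => //; [apply: smooth_linear => // x|exact: smooth_cst].
Qed.

Lemma point_slice_smooth (U : set ((E * E) * R)) (x : E * E) : open U ->
  open [set s : R | U (x, s)] /\ smooth_on [set s : R | U (x, s)] (fun s : R => (x, s)).
Proof.
move=> oU; have oV : open [set s : R | U (x, s)].
  apply: (@open_comp _ _ (fun s : R => (x, s))) => // s _.
  by apply/differentiable_continuous/differentiable_pair; exact: ex_diff.
by split => //; apply: smooth_pair => //; [exact: smooth_cst|apply: smooth_linear => // s].
Qed.

Lemma is_diff_time_slice (x : E * E) (s : R) :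
  is_diff x (fun x : E * E => (x, s)) (fun w => (w, 0)).
Proof. by apply: is_diff_pair. Qed.

Lemma is_diff_point_slice (x : E * E) (s : R) :
  is_diff s (fun s : R => (x, s)) (fun r => (0, r)).
Proof. by apply: is_diff_pair. Qed.

Lemma flow_smooth_at v s : smooth_at (F ^~ s : TM -> TM) v.
Proof.
move=> i j vi vj; have [U [oU Ux Us Ud]] := flow_chart vi vj.
have [oV Vs] := time_slice_smooth s oU.
split.
  by apply: filterS (open_nbhs_nbhs (conj oV Ux)) => x /Ud[].
exists [set x | U (x, s)]; split => //.
by apply: (@smooth_comp _ _ _ _ _ _ (fun x : E * E => (x, s)) (flow_rep i j) fdTR oV _ Vs Us).
Qed.

Lemma flow_curve_smooth_at v s : smooth_at ((fun s => tau (F v s)) : vector_charts R -> M) s.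
Proof.
move=> k j _ vj; pose i := chart_at TM v; have vi : dom TM i v := atlas_chart_at aT v.
have vE : psi TM i (phi TM i v) = v := atlas_phiK aT vi.
have [U [oU Ux Us Ud]] := flow_chart vi (vj : dom TM j (F v s)).
have [oV Vs] := point_slice_smooth (phi TM i v) oU.
split.
  apply: filterS (open_nbhs_nbhs (conj oV Ux)) => r /Ud[_ h].
  have : dom TM j (F (psi TM i (phi TM i v)) r) := h.
  by rewrite vE.
exists [set r | U (phi TM i v, r)]; split => //.
have h : smooth_on [set r | U (phi TM i v, r)] (fun r => flow_rep i j (phi TM i v, r)).
  exact: (@smooth_comp _ _ _ _ _ U (fun r : R => (phi TM i v, r)) (flow_rep i j) fdTR oV).
apply: eq_smooth (smooth_fst oV h) => // r Ur.
by rewrite -[LHS]/((phi TM j (F (psi TM i (phi TM i v)) r)).1) vE.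
Qed.

Lemma flow_rep_is_diff v (s : R) i j : dom TM i v -> dom TM j (F v s) ->
  is_diff (phi TM i v, s) (flow_rep i j) ('d (flow_rep i j) (phi TM i v, s)).
Proof.
move=> vi vj; have [U [_ Ux Us _]] := flow_chart vi vj.
by apply/differentiableP; exact: (smooth_differentiable Us).
Qed.

Lemma differential_flow v (s : R) (V : tangent_space v) i j :
  dom TM i v -> dom TM j (F v s) ->
  differential (F ^~ s : TM -> TM) V j = 'd (flow_rep i j) (phi TM i v, s) (V i, 0).
Proof.
move=> vi vj; rewrite (differentialE aT aT _ (@flow_smooth_at v s) vi vj).
by rewrite (diff_eq (is_diff_comp (is_diff_time_slice (phi TM i v) s) (flow_rep_is_diff vi vj))).
Qed.

Lemma differential_base_flow v (s : R) (V : tangent_space v) i j :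
  dom TM i v -> dom TM j (F v s) ->
  differential ((fun v => tau (F v s)) : TM -> M) V j =
  ('d (flow_rep i j) (phi TM i v, s) (V i, 0)).1.
Proof.
move=> vi vj.
have sm : smooth_at ((fun v => tau (F v s)) : TM -> M) v.
  move=> k l vk vl; have [U [oU Ux Us Ud]] := flow_chart vk (vl : dom TM l (F v s)).
  have [oV Vs] := time_slice_smooth s oU.
  split.
    by apply: filterS (open_nbhs_nbhs (conj oV Ux)) => x /Ud[].
  exists [set x | U (x, s)]; split => //.
  exact: (smooth_fst oV (@smooth_comp _ _ _ _ _ U (fun x : E * E => (x, s))
    (flow_rep k l) fdTR oV (fun _ => id) Vs Us)).
rewrite (differentialE aT aM _ sm vi vj).
have h1 := is_diff_comp (is_diff_time_slice (phi TM i v) s) (flow_rep_is_diff vi vj).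
have h2 : is_diff ((flow_rep i j \o (fun x => (x, s))) (phi TM i v)) (fst : E * E -> E) fst.
  by apply: is_diff_linear => //; move=> x; exact: cvg_fst.
by rewrite (diff_eq (is_diff_comp h1 h2)).
Qed.

End flow.

(** * The variation of the momentum and of the action *)

Section linear_identities.
Context {R : realType} {E : normedModType R}.

(** The algebra of the first variation: [l] is the differential of [L], [u] is (delta q, delta q'),
    and [c] is the derivative along the motion of dL/dq' applied to delta q. The inner difference on
    the right is then the Euler-Lagrange term. *)
Lemma linear_split_snd (l : {linear (E * E)%type -> R}) (u : E * E) (c : R) :
  c + l (0, u.2) = l u - (l (u.1, 0) - c).
Proof.
have -> : l u = l (u.1, 0) + l (0, u.2).
  rewrite -linearD; congr (l _).
  by case: u => u1 u2; congr pair; rewrite /= ?addr0 ?add0r.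
ring.
Qed.

Lemma linear_local_work (g l l' : {linear (E * E)%type -> R})
    (D : {linear ((E * E) * R)%type -> (E * E)%type}) (a : R) (w w' : E * E) :
  g (a *: w + w') - l (0, (D (a *: w + w', 0)).1) + l' (0, (a *: w + w').1) =
  a * (g w - l (0, (D (w, 0)).1) + l' (0, w.1)) +
  (g w' - l (0, (D (w', 0)).1) + l' (0, w'.1)).
Proof.
have linE (k : {linear (E * E)%type -> R}) u u' : k (a *: u + u') = a * k u + k u'.
  exact: linearP.
have lin1 (k : {linear (E * E)%type -> R}) (u u' : E * E) :
    k (0, (a *: u + u').1) = a * k (0, u.1) + k (0, u'.1).
  rewrite -linE; congr (k _); congr pair.
  by rewrite /= scaler0 addr0.
have -> : D (a *: w + w', 0) = a *: D (w, 0) + D (w', 0).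
  by rewrite -linearP; congr (D _); congr pair; rewrite /= scaler0 addr0.
rewrite linE !lin1; ring.
Qed.

End linear_identities.

Section lagrangian_flow.
Context {R : realType} {E : normedModType R} {M : charts E}.
Hypotheses (fdE : finite_dim E) (aM : is_atlas M).
Local Notation TM := (tangent_bundle M).
Variable L : TM -> R.
Hypothesis sL : smooth_map (L : TM -> vector_charts R).
Variable F : TM -> R -> TM.
Hypothesis sF :
  smooth_map ((fun z => F z.1 z.2) : prod_charts TM (vector_charts R) -> TM).
Hypothesis lift_flow : forall v s, Defs.lift (fun s => tau (F v s)) s = F v s.
Hypothesis flow0 : forall v, F v 0 = v.
Let aT : is_atlas TM := tangent_bundle_is_atlas fdE aM.
Let fdT : finite_dim (E * E)%type := finite_dim_prod fdE fdE.
Let fdTR : finite_dim ((E * E) * R)%type := finite_dim_prod fdT finite_dim_real.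
Local Notation Lloc := (local_lagrangian L).
Local Notation dLloc := (local_lagrangian_is_diff fdE aM sL).

Lemma flow_rep_phi v s i j : dom TM i v -> flow_rep F i j (phi TM i v, s) = phi TM j (F v s).
Proof. by move=> vi; rewrite /flow_rep [(_, s).1]/= (atlas_phiK aT vi). Qed.

Lemma flow_rep_im v s i j : dom TM i v -> dom TM j (F v s) ->
  @chart_image _ _ TM j (flow_rep F i j (phi TM i v, s)).
Proof. by move=> vi vj; rewrite flow_rep_phi//; exact: chart_image_phi. Qed.

Let flow_curve_is_diff v (s : R) i j : dom TM i v -> dom TM j (F v s) ->
  is_diff s (fun r => flow_rep F i j (phi TM i v, r))
    (fun r => 'd (flow_rep F i j) (phi TM i v, s) (0, r)).
Proof.
move=> vi vj.
exact: (is_diff_comp (is_diff_point_slice (phi TM i v) s)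
  (flow_rep_is_diff fdE aM sF vi vj)).
Qed.

Let is_diff_fst (z : E * E) : is_diff z (fst : E * E -> E) fst.
Proof. by apply: is_diff_linear => // x; exact: cvg_fst. Qed.

Let is_diff_snd (z : E * E) : is_diff z (snd : E * E -> E) snd.
Proof. by apply: is_diff_linear => // x; exact: cvg_snd. Qed.

Let base_curveE v i j : dom TM i v ->
  phi M j \o (fun s => tau (F v s)) = (fun r => (flow_rep F i j (phi TM i v, r)).1).
Proof. by move=> vi; apply/funext => r; rewrite flow_rep_phi. Qed.

Lemma derive1_base_curve v (s : R) i j : dom TM i v -> dom TM j (F v s) ->
  derive1 (phi M j \o (fun s => tau (F v s))) s =
  ('d (flow_rep F i j) (phi TM i v, s) (0, 1)).1.
Proof.
move=> vi vj; rewrite (base_curveE j vi).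
exact: (is_diff_derive1 (is_diff_comp (flow_curve_is_diff vi vj) (is_diff_fst _))).
Qed.

(** The second order property of the flow in coordinates: by [lift_flow], the fibre coordinate is
    the time derivative of the base coordinate. *)
Lemma flow_rep_velocity v (s : R) i j : dom TM i v -> dom TM j (F v s) ->
  ('d (flow_rep F i j) (phi TM i v, s) (0, 1)).1 = (flow_rep F i j (phi TM i v, s)).2.
Proof.
move=> vi vj; rewrite -(derive1_base_curve vi vj) flow_rep_phi// -lift_flow.
by rewrite -(velocityE aM (@flow_curve_smooth_at _ _ _ fdE aM _ sF v s)).
Qed.

(** The velocity identity holds for all times near [s], so the acceleration is the time derivative
    of the fibre coordinate. Thus the pair (v, a) in [euler_lagrange] is exactly the time derivative
    of the flow in the chart. *)
Lemma jet2_flow v (s : R) i j : dom TM i v -> dom TM j (F v s) ->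
  sval (jet2 (fun s => tau (F v s)) s) j = 'd (flow_rep F i j) (phi TM i v, s) (0, 1).
Proof.
move=> vi vj.
rewrite (jet2E (@flow_curve_smooth_at _ _ _ fdE aM _ sF v s))//.
rewrite [RHS]surjective_pairing (derive1_base_curve vi vj); congr pair.
have [U [oU Ux Us Ud]] := flow_chart fdE aM sF vi vj.
have [oV Vs] := point_slice_smooth (phi TM i v) oU.
have h := is_diff_comp (flow_curve_is_diff vi vj) (is_diff_snd _).
have /is_diff_near/(_ h)/is_diff_derive1 -> // : \forall r \near s,
  (snd \o (fun r => flow_rep F i j (phi TM i v, r))) r =
  derive1 (phi M j \o (fun s => tau (F v s))) r.
apply: filterS (open_nbhs_nbhs (conj oV Ux)) => r /Ud[_ h'].
have vj' : dom TM j (F v r).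
  by have : dom TM j (F (psi TM i (phi TM i v)) r) := h'; rewrite (atlas_phiK aT vi).
by rewrite (derive1_base_curve vi vj') (flow_rep_velocity vi vj').
Qed.

Definition momentum (v : TM) (V : tangent_space v) (s : R) : R :=
  lagrangian_form1 L (differential (F ^~ s : TM -> TM) V).

(** No chart at the end point occurs, so this function is smooth for all times even when the
    trajectory leaves every single chart; it can therefore be integrated over [0, t]. *)
Definition lagrangian_along (i : idx TM) (z : (E * E) * R) : R :=
  L (F (psi TM i z.1) z.2).

Definition local_momentum (i j : idx TM) (w : E * E) (z : (E * E) * R) : R :=
  'd (Lloc j) (flow_rep F i j z) (0, ('d (flow_rep F i j) z (w, 0)).1).

Lemma momentumE v (V : tangent_space v) s i j : dom TM i v -> dom TM j (F v s) ->
  momentum V s = local_momentum i j (V i) (phi TM i v, s).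
Proof.
move=> vi vj; rewrite /momentum (lagrangian_form1E fdE aM sL _ vj).
by rewrite (differential_flow fdE aM sF _ vi vj) /local_momentum flow_rep_phi.
Qed.

Lemma lagrangian_along_near v (s : R) i j : dom TM i v -> dom TM j (F v s) ->
  \forall z \near (phi TM i v, s), (Lloc j \o flow_rep F i j) z = lagrangian_along i z.
Proof.
move=> vi vj; have [U [oU Ux Us Ud]] := flow_chart fdE aM sF vi vj.
apply: filterS (open_nbhs_nbhs (conj oU Ux)) => z /Ud[_ zj].
by rewrite /= /local_lagrangian /flow_rep (atlas_phiK aT zj).
Qed.

Lemma lagrangian_along_smooth i :
  smooth_on (@chart_image _ _ TM i `*` setT) (lagrangian_along i).
Proof.
apply: smooth_local => -[x s] [/= xi _].
have vi := psi_dom aT xi; have vj := atlas_chart_at aT (F (psi TM i x) s).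
have [U [oU Ux Us Ud]] := flow_chart fdE aM sF vi vj.
rewrite (atlas_psiK aT xi) in Ux.
exists U; split => //.
apply: (@eq_smooth _ _ _ _ (Lloc (chart_at TM (F (psi TM i x) s)) \o
   flow_rep F i (chart_at TM (F (psi TM i x) s)))) => //.
  by move=> z /Ud[_ zj]; rewrite /= /local_lagrangian /flow_rep (atlas_phiK aT zj).
apply: (@smooth_comp _ _ _ _ _ _ _ _ fdT oU _ Us (local_lagrangian_smooth fdE aM sL _)).
by move=> z /Ud[_ zj]; exact: chart_image_phi.
Qed.

Lemma diff_lagrangian_along v (s : R) i j (u : (E * E) * R) :
  dom TM i v -> dom TM j (F v s) ->
  'd (lagrangian_along i) (phi TM i v, s) u =
  'd (Lloc j) (flow_rep F i j (phi TM i v, s)) ('d (flow_rep F i j) (phi TM i v, s) u).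
Proof.
move=> vi vj.
have h := is_diff_comp (flow_rep_is_diff fdE aM sF vi vj) (dLloc (flow_rep_im vi vj)).
by rewrite (diff_eq (is_diff_near (lagrangian_along_near vi vj) h)).
Qed.

Lemma local_momentum_smooth (U : set ((E * E) * R)) i j w :
  open U -> smooth_on U (flow_rep F i j) ->
  (forall z, U z -> dom TM j (F (psi TM i z.1) z.2)) ->
  smooth_on U (local_momentum i j w).
Proof.
move=> oU Us Ud.
apply: (@smooth_diff_comp _ _ _ _ U _ (flow_rep F i j)
  (fun z => (0, ('d (flow_rep F i j) z (w, 0)).1)) (Lloc j) fdT oU _ Us _
  (local_lagrangian_smooth fdE aM sL j)).
  by move=> z /Ud zj; exact: chart_image_phi.
apply: smooth_pair => //; first exact: smooth_cst.
by apply: smooth_fst => //; exact: smooth_diff.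
Qed.

(** Here [j] is forced to be the preferred chart, the one in which [euler_lagrange] is defined. *)
Lemma euler_lagrange_flow v (V : tangent_space v) i (s : R) : dom TM i v ->
  let j := chart_at TM (F v s) in
  let D := 'd (flow_rep F i j) (phi TM i v, s) in
  let p := flow_rep F i j (phi TM i v, s) in
  euler_lagrange L (jet2 (fun s => tau (F v s)) s)
    (differential ((fun v' => tau (F v' s)) : TM -> M) V) =
  'd (Lloc j) p ((D (V i, 0)).1, 0) -
  'd (fun z => 'd (Lloc j) z (0, (D (V i, 0)).1)) p (D (0, 1)).
Proof.
move=> vi j D p; have vj : dom TM j (F v s) by exact: (atlas_chart_at aT).
rewrite /euler_lagrange -/(chart_at TM (F v s)) -/j (jet2_flow vi vj).
rewrite (differential_base_flow fdE aM sF _ vi vj) (flow_rep_velocity vi vj).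
have -> : phi M j (tau (F v s)) = p.1 by rewrite /p flow_rep_phi.
by rewrite -/D -/p -surjective_pairing.
Qed.

(* d/dt D_2 L (delta q) = dL (delta q, delta q') - D_EL L (delta q), using that
   the variation of the velocity is the velocity of the variation. *)
Lemma momentum_derive v (V : tangent_space v) i (s : R) : dom TM i v ->
  is_derive s (1 : R) (momentum V)
    ('d (lagrangian_along i) (phi TM i v, s) (V i, 0) -
     euler_lagrange L (jet2 (fun s => tau (F v s)) s)
       (differential ((fun v' => tau (F v' s)) : TM -> M) V)).
Proof.
move=> vi; pose j : idx TM := chart_at M (tau (F v s)).
have vj : dom TM j (F v s) by exact: (atlas_chart_at aM).
have [U [oU Ux Us Ud]] := flow_chart fdE aM sF vi vj.
have [oV Vs] := point_slice_smooth (phi TM i v) oU.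
set x := phi TM i v in Ux oV Vs *; set w := V i; pose p := flow_rep F i j (x, s).
(* The chart [j] is known to contain [F v r] only for [r] near [s], which is enough for the
   derivative at [s]. *)
have mE : \forall r \near s, local_momentum i j w (x, r) = momentum V r.
  apply: filterS (open_nbhs_nbhs (conj oV Ux)) => r /Ud[_ h'].
  have vj' : dom TM j (F v r).
    by have : dom TM j (F (psi TM i (phi TM i v)) r) := h'; rewrite (atlas_phiK aT vi).
  by rewrite (momentumE _ vi vj').
have Dw : is_diff (x, s) (fun z => 'd (flow_rep F i j) z (w, 0))
    ('d (fun z => 'd (flow_rep F i j) z (w, 0)) (x, s)).
  by apply/differentiableP; exact: (smooth_differentiable (smooth_diff (w, 0) Us)).
have D1 : is_diff (x, s) (fun z => 'd (flow_rep F i j) z (0, 1))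
    ('d (fun z => 'd (flow_rep F i j) z (0, 1)) (x, s)).
  by apply/differentiableP; exact: (smooth_differentiable (smooth_diff _ Us)).
have hb : is_diff s (fun r => (0 : E, ('d (flow_rep F i j) (x, r) (w, 0)).1))
   (fun r => (0, ('d (fun z => 'd (flow_rep F i j) z (w, 0)) (x, s) (0, r)).1)).
  have h := is_diff_comp (is_diff_point_slice x s) Dw.
  exact: (is_diff_pair (is_diff_cst _ _) (is_diff_comp h (is_diff_fst _))).
have hm := @is_diff_diff_comp _ _ _ _ _ (fun r => flow_rep F i j (x, r)) _ _ _ (Lloc j) s fdT (flow_rep_im vi vj) (local_lagrangian_smooth fdE aM sL j)
  (flow_curve_is_diff vi vj) hb.
have := is_diff_derive (is_diff_near mE hm).
(* The mixed second differential of the flow is swapped, and then the velocity identity, valid on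
   all of [U], is differentiated in the direction [(w, 0)]. *)
have -> : ('d (fun z => 'd (flow_rep F i j) z (w, 0)) (x, s) (0, 1)).1 =
    ('d (flow_rep F i j) (x, s) (w, 0)).2.
  have sym := @diff2_sym _ _ _ U (flow_rep F i j) (x, s) (w, 0) (0, 1 : R) fdT oU Ux Us.
  apply: (etrans (congr1 fst sym)).
  have h1 := is_diff_comp D1 (is_diff_fst _).
  have h2 := is_diff_comp (flow_rep_is_diff fdE aM sF vi vj) (is_diff_snd _).
  have /is_diff_near/(_ h1)/diff_eq e1 : \forall z \near (x, s),
     (fst \o (fun z => 'd (flow_rep F i j) z (0, 1))) z = (snd \o flow_rep F i j) z.
    apply: filterS (open_nbhs_nbhs (conj oU Ux)) => -[y r] /Ud[/= yi yj].
    have := flow_rep_velocity (psi_dom aT yi) yj.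
    by rewrite (atlas_psiK aT yi).
  have := congr1 (@^~ (w, 0)) e1; rewrite (diff_eq h2) => e2.
  exact: (esym e2).
move=> h; apply: is_derive_eq h _.
rewrite (diff_lagrangian_along (w, 0) vi vj) (euler_lagrange_flow V s vi).
rewrite -/(chart_at TM (F v s)) -/j -/x -/w -/p.
exact: linear_split_snd.
Qed.

(** Smoothness is checked near each time with its own target chart. It supplies the continuous
    derivative required by the fundamental theorem of calculus. *)
Lemma momentum_smooth v (V : tangent_space v) : smooth_on setT (momentum V).
Proof.
apply: smooth_local => s _; pose i := chart_at TM v.
have vi : dom TM i v := atlas_chart_at aT v.
have vj := atlas_chart_at aT (F v s).
have [U [oU Ux Us Ud]] := flow_chart fdE aM sF vi vj.
have [oV Vs] := point_slice_smooth (phi TM i v) oU.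
exists [set r | U (phi TM i v, r)]; split => //.
have ms := local_momentum_smooth (V i) oU Us (fun z zU => (Ud z zU).2).
have h := @smooth_comp _ _ _ _ _ U (fun r : R => (phi TM i v, r)) _ fdTR oV (fun _ => id) Vs ms.
apply: eq_smooth h => // r /Ud[_ h'].
have vj' : dom TM (chart_at TM (F v s)) (F v r).
  have : dom TM (chart_at TM (F v s)) (F (psi TM i (phi TM i v)) r) := h'.
  by rewrite (atlas_phiK aT vi).
by rewrite (momentumE _ vi vj').
Qed.

Lemma momentum0 v (V : tangent_space v) : momentum V 0 = lagrangian_form1 L V.
Proof.
(* The type of [differential f V] depends on [f]; abstracting over [f] lets [F ^~ 0] be replaced by
   the identity in both places at once. *)
pose theta (f : TM -> TM) := lagrangian_form1 L (differential f V).
rewrite -[LHS]/(theta (F ^~ 0)).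
have -> : F ^~ 0 = id by apply/funext => u; exact: flow0.
suff dV : differential (id : TM -> TM) V = V :> tangent_space v.
  by rewrite /theta [differential _ _]dV.
have vi := atlas_chart_at aT v; apply: (tangent_ext vi).
rewrite (differentialE aT aT _ (@smooth_at_id _ _ _ aT v) vi vi).
exact: (esym (tangent_change V vi vi)).
Qed.

(** * The form nu: local expression, smoothness and exterior derivative *)

Definition action_along (i : idx TM) (t : R) (x : E * E) : R :=
  oriented_integral 0 t (fun s => lagrangian_along i (x, s)).

Lemma action_along_smooth i t :
  smooth_on (@chart_image _ _ TM i) (action_along i t).
Proof.
move=> k; apply: (parameter_integral_Ck (chart_image_open aT i) fdT).
exact: lagrangian_along_smooth.
Qed.

(** The form nu of the theorem, stated for a smooth [F] and [L]. *)
Definition virtual_work (t : R) : form1 TM := fun v V =>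
  oriented_integral 0 t (fun s =>
    euler_lagrange L (jet2 (fun s => tau (F v s)) s)
      (differential ((fun v' => tau (F v' s)) : TM -> M) V)).

Lemma virtual_workE t v (V : tangent_space v) i : dom TM i v ->
  virtual_work t V = 'd (action_along i t) (phi TM i v) (V i) -
    momentum V t + lagrangian_form1 L V.
Proof.
move=> vi; have xi : @chart_image _ _ TM i (phi TM i v) := chart_image_phi vi.
have gs := lagrangian_along_smooth i.
rewrite (diff_eq (parameter_integral_is_diff (chart_image_open aT i) fdT t (gs 1%N) xi)).
rewrite -(momentum0 V) -addrA [- _ + _]addrC -opprB.
(* This expression of the derivative of the momentum is continuous by smoothness; [momentum_derive]
   then identifies it at each [s]. The Euler-Lagrange integrand thus needs no continuity proof of
   its own across charts. *)
pose dm s := 'd (momentum V) s (1 : R).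
have dmc : continuous dm.
  by move=> s; exact: (@smooth_continuous _ _ _ setT dm s (smooth_diff _ (momentum_smooth V)) I).
have dlc : continuous (fun s => 'd (lagrangian_along i) (phi TM i v, s) (V i, 0)).
  have := smooth_diff (V i, 0) gs => gs'.
  exact: (parameter_continuous (gs' 0%N) xi).
have md (s : R) : is_derive s (1 : R) (momentum V) (dm s).
  apply: is_diff_derive; apply/differentiableP.
  exact: (@smooth_differentiable _ _ _ setT _ s (momentum_smooth V)).
rewrite -(oriented_integral_FTC 0 t dmc md) -oriented_integralB//.
congr oriented_integral; apply/funext => s.
have /(@derive_val _ _ _ _ _ _ _) <- := md s.
have /(@derive_val _ _ _ _ _ _ _) -> := momentum_derive V s vi.
by rewrite subKr.
Qed.

(** Only the end time [t] calls for a target chart, so a single [j] serves for all initial points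
    near a given one, and nu can be differentiated there. *)
Lemma virtual_work_local i j t w x : @chart_image _ _ TM i x ->
  dom TM j (F (psi TM i x) t) ->
  virtual_work t (tangent_vector i (psi TM i x) w) =
  'd (action_along i t) x w - local_momentum i j w (x, t) + 'd (Lloc i) x (0, w.1).
Proof.
move=> xi xj; have vi := psi_dom aT xi.
rewrite (virtual_workE t _ vi) (momentumE _ vi xj) (lagrangian_form1E fdE aM sL _ vi).
by rewrite (atlas_psiK aT xi) (tangent_vectorK aT _ vi).
Qed.

Lemma virtual_work_linear t v (a : R) (V W : tangent_space v) :
  virtual_work t (a *: V + W) = a * virtual_work t V + virtual_work t W.
Proof.
pose i := chart_at TM v; have vi : dom TM i v := atlas_chart_at aT v.
pose j := chart_at TM (F v t); have vj : dom TM j (F v t) := atlas_chart_at aT _.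
rewrite !(virtual_workE t _ vi) !(momentumE _ vi vj) !(lagrangian_form1E fdE aM sL _ vi).
rewrite tangent_lin; set w := V _; set w' := W _; set x := phi TM i v.
exact: linear_local_work.
Qed.

Lemma virtual_work_smooth t : smooth_form1 (virtual_work t).
Proof.
split=> [v a V W|i w]; first exact: virtual_work_linear.
apply: smooth_local => x xi.
have vi := psi_dom aT xi; have vj := atlas_chart_at aT (F (psi TM i x) t).
have [U [oU Ux Us Ud]] := flow_chart fdE aM sF vi vj.
rewrite (atlas_psiK aT xi) in Ux.
have [oV Vs] := time_slice_smooth t oU.
exists [set y | U (y, t)]; split => //.
apply: (@eq_smooth _ _ _ _ (fun y => 'd (action_along i t) y w
  - local_momentum i (chart_at TM (F (psi TM i x) t)) w (y, t) + 'd (Lloc i) y (0, w.1))).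
- exact: oV.
- by move=> y /Ud[/= yi yj]; rewrite (virtual_work_local w yi yj).
have sub : [set y | U (y, t)] `<=` @chart_image _ _ TM i by move=> y /Ud[].
apply: smoothD => //; [apply: smoothB => //|].
- exact: (sub_smooth sub (smooth_diff w (action_along_smooth i t))).
- have ms := local_momentum_smooth w oU Us (fun z zU => (Ud z zU).2).
  exact: (@smooth_comp _ _ _ _ _ U (fun y : E * E => (y, t)) _ fdTR oV (fun _ => id) Vs ms).
- exact: (sub_smooth sub (smooth_diff _ (local_lagrangian_smooth fdE aM sL i))).
Qed.

Lemma exterior_lagrangian_form1 v (V W : tangent_space v) :
  let i := chart_at TM v in
  exterior_derivative (lagrangian_form1 L) V W =
  'd (fun z => 'd (Lloc i) z (0, (W i).1)) (phi TM i v) (V i) -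
  'd (fun z => 'd (Lloc i) z (0, (V i).1)) (phi TM i v) (W i).
Proof.
move=> i; have vi : dom TM i v := atlas_chart_at aT v.
have xi : @chart_image _ _ TM i (phi TM i v) := chart_image_phi vi.
have dE w u : 'd (fun x => lagrangian_form1 L (tangent_vector i (psi TM i x) w)) (phi TM i v) u =
    'd (fun z => 'd (Lloc i) z (0, w.1)) (phi TM i v) u.
  apply: (congr1 (@^~ u)); apply: near_eq_diff; last first.
    exact: (smooth_differentiable (smooth_diff _ (local_lagrangian_smooth fdE aM sL i))).
  apply: filterS (open_nbhs_nbhs (conj (chart_image_open aT i) xi)) => x xI.
  rewrite (lagrangian_form1E fdE aM sL _ (psi_dom aT xI)) (atlas_psiK aT xI).
  by rewrite (tangent_vectorK aT _ (psi_dom aT xI)).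
exact: (congr2 (fun a b => a - b) (dE _ _) (dE _ _)).
Qed.

(** The first term comes from moving the base point of ['d (Lloc j)], the second from the second
    differential of the flow and is therefore symmetric in [w] and [u]. *)
Lemma diff_local_momentum v t i j (w : E * E) : dom TM i v -> dom TM j (F v t) ->
  let D := 'd (flow_rep F i j) (phi TM i v, t) in
  let p := flow_rep F i j (phi TM i v, t) in
  is_diff (phi TM i v) (fun x => local_momentum i j w (x, t))
    (fun u => 'd (fun y => 'd (Lloc j) y (0, (D (w, 0)).1)) p (D (u, 0)) +
     'd (Lloc j) p (0, ('d (fun z => 'd (flow_rep F i j) z (w, 0)) (phi TM i v, t) (u, 0)).1)).
Proof.
move=> vi vj D p; have [U [oU Ux Us Ud]] := flow_chart fdE aM sF vi vj.
have hs := is_diff_time_slice (phi TM i v) t.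
have Dw : is_diff (phi TM i v, t) (fun z => 'd (flow_rep F i j) z (w, 0))
    ('d (fun z => 'd (flow_rep F i j) z (w, 0)) (phi TM i v, t)).
  by apply/differentiableP; exact: (smooth_differentiable (smooth_diff _ Us)).
have hb := is_diff_pair (is_diff_cst (0 : E) (phi TM i v))
  (is_diff_comp (is_diff_comp hs Dw) (is_diff_fst _)).
have hf := is_diff_comp hs (flow_rep_is_diff fdE aM sF vi vj).
exact: (@is_diff_diff_comp _ _ _ _ _ (fun x => flow_rep F i j (x, t)) _ _ _ (Lloc j) _ fdT
  (flow_rep_im vi vj) (local_lagrangian_smooth fdE aM sL j) hf hb).
Qed.

(** After antisymmetrisation, [S] gives d theta_L at [v] and [T] its pullback by the flow at time
    [t]; what remains, [G] and [C], is symmetric and cancels. Taking [j] to be the preferred chart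
    at [F v t] matches the chart built into [exterior_derivative]. *)
Lemma pullback_lagrangian_form2 t v (V W : tangent_space v) :
  pullback2 (F ^~ t : TM -> TM) (lagrangian_form2 L) V W =
  lagrangian_form2 L V W + exterior_derivative (virtual_work t) V W.
Proof.
pose i := chart_at TM v; have vi : dom TM i v := atlas_chart_at aT v.
pose j := chart_at TM (F v t); have vj : dom TM j (F v t) := atlas_chart_at aT _.
have [U [oU Ux Us Ud]] := flow_chart fdE aM sF vi vj.
have [oV Vs] := time_slice_smooth t oU.
have xi : @chart_image _ _ TM i (phi TM i v) := chart_image_phi vi.
set x := phi TM i v in Ux xi *; set D := 'd (flow_rep F i j) (x, t).
set p := flow_rep F i j (x, t).
pose T w u := 'd (fun y => 'd (Lloc j) y (0, (D (w, 0)).1)) p (D (u, 0)).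
pose C w u := 'd (Lloc j) p (0, ('d (fun z => 'd (flow_rep F i j) z (w, 0)) (x, t) (u, 0)).1).
pose G w u := 'd (fun y => 'd (action_along i t) y w) x u.
pose S (w u : E * E) := 'd (fun z : E * E => 'd (Lloc i) z (0, w.1)) x u.
have thV : exterior_derivative (lagrangian_form1 L) V W =
    S (W i) (V i) - S (V i) (W i).
  exact: exterior_lagrangian_form1.
have thF : exterior_derivative (lagrangian_form1 L)
    (differential (F ^~ t : TM -> TM) V) (differential (F ^~ t : TM -> TM) W) =
    T (W i) (V i) - T (V i) (W i).
  rewrite exterior_lagrangian_form1 -/j !(differential_flow fdE aM sF _ vi vj).
  by rewrite -(flow_rep_phi t j vi).
have dE (w u : E * E) :
  'd (fun y => virtual_work t (tangent_vector i (psi TM i y) w)) x u =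
  G w u - (T w u + C w u) + S w u.
  have h1 : is_diff x (fun y => 'd (action_along i t) y w) (G w).
    apply/differentiableP.
    exact: (smooth_differentiable (smooth_diff _ (action_along_smooth i t))).
  have h3 : is_diff x (fun z => 'd (Lloc i) z (0, w.1)) (S w).
    apply/differentiableP.
    exact: (smooth_differentiable (smooth_diff _ (local_lagrangian_smooth fdE aM sL i))).
  have h := is_diffD (is_diffB h1 (diff_local_momentum w vi vj)) h3.
  have hn : \forall y \near x,
     ((fun y => 'd (action_along i t) y w) - (fun y => local_momentum i j w (y, t))
      + (fun z => 'd (Lloc i) z (0, w.1))) y =
     virtual_work t (tangent_vector i (psi TM i y) w).
    apply: filterS (open_nbhs_nbhs (conj oV Ux)) => y /Ud[/= yi yj].
    exact: (esym (virtual_work_local w yi yj)).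
  exact: (congr1 (@^~ u) (diff_eq (is_diff_near hn h))).
have extE : exterior_derivative (virtual_work t) V W =
    (G (W i) (V i) - (T (W i) (V i) + C (W i) (V i)) + S (W i) (V i))
    - (G (V i) (W i) - (T (V i) (W i) + C (V i) (W i)) + S (V i) (W i)).
  exact: (congr2 (fun a b => a - b) (dE _ _) (dE _ _)).
(* This is d d = 0 for the action integral. *)
have GC : G (V i) (W i) = G (W i) (V i).
  exact: (diff2_sym _ _ finite_dim_real (chart_image_open aT i) xi (action_along_smooth i t)).
(* This is the commutation of d with the pullback by the flow at time [t]. *)
have CC : C (V i) (W i) = C (W i) (V i).
  apply: (congr1 (fun e : E * E => 'd (Lloc j) p (0, e.1))).
  exact: (@diff2_sym _ _ _ U (flow_rep F i j) (x, t) (V i, 0) (W i, 0) fdT oU Ux Us).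
rewrite /pullback2 /lagrangian_form2 thF thV extE GC CC.
move: (T _ _) (T _ _) (S _ _) (S _ _) (G _ _) (C _ _) => a1 a2 a3 a4 a5 a6; ring.
Qed.

End lagrangian_flow.

(** The membership of [nu] in Omega^1(TQ) is part of the claim: [exterior_derivative] is a total
    operation, whose value deserves the name d nu once [nu] is a smooth form. *)
Theorem theorem2p4 (R : realType) (n : nat) (Q : manifold R n) (S : socs Q)
    (F : tangent_bundle Q -> R -> tangent_bundle Q) (hF : is_flow S F) (t : R) :
  let L := lagrangian S in
  let nu : form1 (tangent_bundle Q) := fun v (V : tangent_space v) =>
    let gamma s := tau (F v s) in
    let delta_q s : tangent_space (gamma s) :=
      differential (fun v' => tau (F v' s)) V in
    oriented_integral 0 t (fun s => euler_lagrange L (jet2 gamma s) (delta_q s)) in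
  smooth_form1 nu /\
  forall (v : tangent_bundle Q) (V W : tangent_space v),
    pullback2 (F ^~ t) (lagrangian_form2 L) V W =
    lagrangian_form2 L V W + exterior_derivative nu V W.
Proof.
move=> L nu; have [sF hc] := hF.
have lift_flow v s : Defs.lift (fun s => tau (F v s)) s = F v s by have [] := hc v.
(* Both sides are the velocity at time 0 of the trajectory of [v]. *)
have flow0 v : F v 0 = v by have [_ + _] := hc v; rewrite lift_flow.
have fdE := @finite_dim_row R n; have aM := manifold_is_atlas Q.
have sL := @lagrangian_smooth _ _ _ S.
split; first exact: (virtual_work_smooth fdE aM sL sF lift_flow flow0 t).
by move=> v V W; exact: (pullback_lagrangian_form2 fdE aM sL sF lift_flow flow0 t V W).
Qed.
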